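(* Let $1<p<\infty$, $p\neq2$, and let $Y$ be a finite-dimensional subspace of the real Banach space $\ell_p$. Then $Y$ has property-$(HB)$ in $\ell_p$ if and only if there exists a bi-contractive projection $P:\ell_p\to Y$ onto $Y$ such that $Y$ and $(I-P)(\ell_p)$ are isometrically isomorphic to $\ell_p(\dim(Y))$ and $\ell_p$, respectively.
   Context: $\ell_p(n)$ is $\mathbb{R}^n$ with the $\ell_p$-norm. For a closed subspace $Y$ of a Banach space $X$, $Y^\perp=\{x^*\in X^*: x^*(y)=0\ \forall y\in Y\}$. $Y$ has property-$(HB)$ in $X$ if there is a closed subspace $G$ of $X^*$ with $X^*=G\oplus Y^\perp$ such that for each $x^*\in X^*$, $\|x^*\|>\|y^\#\|$ and $\|x^*\|\ge\|y^\perp\|$ whenever $x^*=y^\#+y^\perp$ with $y^\#\in G$ and $0\ne y^\perp\in Y^\perp$. A linear projection $P$ is bi-contractive if $\|P\|\le1$ and $\|I-P\|\le 1$. *)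

(* Defs.v *)
From HB Require Import structures.
From mathcomp Require Import all_boot all_order all_algebra.
From mathcomp Require Import all_classical all_reals all_analysis.

Set Implicit Arguments.
Unset Strict Implicit.
Unset Printing Implicit Defensive.
Import Order.TTheory GRing.Theory Num.Theory.
Import numFieldNormedType.Exports.

Local Open Scope classical_set_scope.
Local Open Scope ring_scope.

Section operator_norm.
Context {R : realType} {E F : normedModType R}.

(* Extended-real valued, so that it is +oo (and not a junk value) when f is
   unbounded on the unit ball. *)
Definition opnorm (f : E -> F) : \bar R :=
  ereal_sup [set (`|f x|)%:E | x in [set x : E | `|x| <= 1]].

Lemma opnorm_ge (f : E -> F) x : `|x| <= 1 -> ((`|f x|)%:E <= opnorm f)%E.
Proof. by move=> x1; apply: ereal_sup_ubound; exists x. Qed.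

Lemma opnorm_le (f : E -> F) (M : \bar R) :
  (forall x, `|x| <= 1 -> ((`|f x|)%:E <= M)%E) -> (opnorm f <= M)%E.
Proof. by move=> fM; apply: ge_ereal_sup => _ [x /= x1 <-]; exact: fM. Qed.

Lemma opnorm_ge0 (f : E -> F) : (0 <= opnorm f)%E.
Proof.
apply: (@le_trans _ _ (`|f 0|)%:E); first by rewrite lee_fin.
by apply: opnorm_ge; rewrite normr0.
Qed.

Lemma opnorm_lty (f : {linear E -> F}) : continuous f -> (opnorm f < +oo)%E.
Proof.
move=> /linear_bounded_continuous/bounded_funP/(_ 1)[M fM].
apply: (@le_lt_trans _ _ M%:E); last exact: ltry.
by apply: opnorm_le => x x1; rewrite lee_fin; exact: fM.
Qed.

End operator_norm.

Section dual.
Context {R : realType} (X : normedModType R).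

Definition dual_pred : {pred X -> R^o} :=
  mem [set f : X -> R^o | linear f /\ continuous f].

Record dual : Type := Dual {
  dual_fun :> X -> R^o ;
  dual_funP : dual_fun \in dual_pred }.

HB.instance Definition _ := [isSub for dual_fun].
HB.instance Definition _ := [Choice of dual by <:].

Lemma dual_submod_closed : submod_closed dual_pred.
Proof.
split.
  rewrite inE; split; last by move=> x; exact: cvg_cst.
  by move=> a u v /=; rewrite scaler0 addr0.
move=> a f g /[!inE] -[lf cf] [lg cg]; split.
  move=> b u v /=; rewrite !fctE lf lg !scalerDr addrACA.
  by rewrite !scalerA (mulrC a).
by move=> x; apply: cvgD; [apply: cvgZl_tmp; exact: cf|exact: cg].
Qed.

HB.instance Definition _ :=
  GRing.isSubmodClosed.Build R (X -> R^o) dual_pred dual_submod_closed.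
HB.instance Definition _ := [SubChoice_isSubLmodule of dual by <:].

Lemma dual_linear (f : dual) : linear f.
Proof. by have /[!inE] -[] := dual_funP f. Qed.

Lemma dual_continuous (f : dual) : continuous f.
Proof. by have /[!inE] -[] := dual_funP f. Qed.

HB.instance Definition _ (f : dual) :=
  GRing.isLinear.Build R X R^o _ (dual_fun f) (@dual_linear f).

Let dnorm (f : dual) : R := fine (opnorm f).

Let dnormE (f : dual) : (dnorm f)%:E = opnorm f.
Proof.
rewrite fineK// ge0_fin_numE ?opnorm_ge0//.
exact/opnorm_lty/dual_continuous.
Qed.

Let dnorm_ge (f : dual) x : `|x| <= 1 -> `|f x| <= dnorm f.
Proof. by move=> x1; rewrite -lee_fin dnormE opnorm_ge. Qed.

Let dnorm_le (f : dual) M :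
  (forall x, `|x| <= 1 -> `|f x| <= M) -> dnorm f <= M.
Proof.
by move=> fM; rewrite -lee_fin dnormE opnorm_le// => x x1; rewrite lee_fin fM.
Qed.

Let dnormD (f g : dual) : dnorm (f + g) <= dnorm f + dnorm g.
Proof.
apply: dnorm_le => x x1; apply: (le_trans (ler_normD (f x) (g x))).
by apply: lerD; exact: dnorm_ge.
Qed.

Let dnormZ_le a (f : dual) : dnorm (a *: f) <= `|a| * dnorm f.
Proof.
apply: dnorm_le => x x1.
have -> : `|(a *: f) x| = `|a| * `|f x| by rewrite -normrM.
by apply: ler_wpM2l => //; exact: dnorm_ge.
Qed.

Let dnormZ a (f : dual) : dnorm (a *: f) = `|a| * dnorm f.
Proof.
apply/eqP; rewrite eq_le dnormZ_le/=.
have [->|a0] := eqVneq a 0.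
  by rewrite normr0 mul0r fine_ge0// opnorm_ge0.
rewrite -ler_pdivlMl ?normr_gt0// -normfV.
by rewrite -[X in dnorm X <= _](scalerK a0) dnormZ_le.
Qed.

Let dnorm_eq0 (f : dual) : dnorm f = 0 -> f = 0.
Proof.
move=> f0; apply/val_inj/funext => x /=.
have [->|x0] := eqVneq x 0; first by rewrite linear0.
have : `|f (`|x|^-1 *: x)| <= 0.
  by rewrite -f0 dnorm_ge// normrZ normfV normr_id mulVf// normr_eq0.
rewrite normr_le0 linearZ/= scaler_eq0 invr_eq0 normr_eq0 (negbTE x0)/=.
by move=> /eqP.
Qed.

HB.instance Definition _ := @Lmodule_isNormed.Build R dual
  dnorm dnormD dnormZ dnorm_eq0.

Lemma dual_normE (f : dual) : `|f| = fine (opnorm f).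
Proof. by []. Qed.

End dual.

Section property_HB.
Context {R : realType} {X : normedModType R}.
Implicit Types Y : set X.

Definition annihilator Y : set (dual X) :=
  [set f | forall y, Y y -> f y = 0].

Definition direct_sum {V : lmodType R} (G H : set V) :=
  G `&` H = [set 0] /\ forall v, exists g h, [/\ G g, H h & v = g + h].

Definition property_HB Y := exists G : set (dual X),
  [/\ submod_closed (mem G), closed G, direct_sum G (annihilator Y) &
   forall f g h : dual X, G g -> annihilator Y h -> h <> 0 -> f = g + h ->
     `|g| < `|f| /\ `|h| <= `|f|].

Definition has_dim Y (n : nat) := exists e : 'I_n -> X,
  (forall a : 'I_n -> R, \sum_i a i *: e i = 0 -> forall i, a i = 0) /\
  Y = [set \sum_i a i *: e i | a in [set: 'I_n -> R]].

Definition projection_onto (P : {linear X -> X}) Y :=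
  (forall x, P (P x) = P x) /\ range P = Y.

Definition bi_contractive (P : X -> X) :=
  (opnorm P <= 1)%E /\ (opnorm (fun x => (x - P x)%R) <= 1)%E.

Definition isometrically_isomorphic Y (E : normedModType R) :=
  exists T : {linear E -> X}, (forall x, `|T x| = `|x|) /\ range T = Y.

End property_HB.

Section ell.
Context {R : realType} {p : R} (p1 : 1 <= p).
Local Open Scope ereal_scope.

Definition ell : Type := LfunType (@counting nat R) (p1 : 1 <= p%:E).

HB.instance Definition _ := GRing.Lmodule.on ell.

Definition ell_fun (x : ell) : nat -> R := x.
Coercion ell_fun : ell >-> Funclass.

Let norm (x : ell) : R := fine ('N[counting]_p%:E[EFin \o x]).

Let normE (x : ell) : (norm x)%:E = 'N[counting]_p%:E[EFin \o x].
Proof. exact: finite_norm_fine. Qed.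

Let normD (x y : ell) : (norm (x + y) <= norm x + norm y)%R.
Proof. exact: ler_LnormD. Qed.

Let normZ (a : R) (x : ell) : norm (a *: x) = (`|a| * norm x)%R.
Proof.
apply/EFin_inj; rewrite EFinM !normE.
exact: (@LnormZ _ _ _ _ _ (p1 : 1 <= p%:E)).
Qed.

Let norm_eq0 (x : ell) : norm x = 0%R -> x = 0%R.
Proof.
move=> x0.
have [A [_ A0 xA]] := @fine_Lnormr_eq0 _ _ _ _ _ (p1 : 1 <= p%:E) x x0.
have {}A0 : A = set0.
  move: A0; rewrite /= /counting; case: asboolP => [fA [/eqP]|//].
  by rewrite pnatr_eq0 finmap.cardfs_eq0 => /eqP; exact: fset_set_set0.
apply/val_inj/funext => k /=; apply: contrapT => xk.
have : A k by apply: xA => /= h; exact: xk (h I).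
by rewrite A0.
Qed.

HB.instance Definition _ := @Lmodule_isNormed.Build R ell
  norm normD normZ norm_eq0.

Lemma ell_normE (x : ell) :
  (`|x|%R)%:E = (\sum_(k <oo) (`|x k| `^ p)%:E) `^ p^-1.
Proof.
have p0 : (0 < p)%R by exact: lt_le_trans p1.
by rewrite [LHS]normE Lnorm_counting.
Qed.

End ell.

(* An alias, so as not to inherit the max norm of 'rV[R]_n; p1 makes p
   recoverable from the type. *)
Definition ell_fin {R : realType} {p : R} (p1 : 1 <= p) (n : nat) : Type :=
  'rV[R]_n.

Section ell_fin.
Context {R : realType} {p : R} (p1 : 1 <= p) (n : nat).
Local Notation ell_fin := (ell_fin p1 n).

HB.instance Definition _ := GRing.Lmodule.on ell_fin.

Let norm (x : ell_fin) : R :=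
  (\sum_(i < n) `|(x : 'rV[R]_n) 0 i| `^ p) `^ p^-1.

Let p0 : 0 < p. Proof. exact: lt_le_trans p1. Qed.

Let ext0 (x : 'rV[R]_n) (k : nat) : R :=
  if insub k is Some i then x 0 i else 0.

Let normE (x : ell_fin) :
  ((norm x)%:E = 'N[counting]_p%:E[EFin \o ext0 x])%E.
Proof.
rewrite Lnorm_counting// (@nneseries_split _ _ 0 n) => [|k _]; last first.
  exact: poweR_ge0.
rewrite eseries0 ?adde0 => [|k + _]; last first.
  rewrite add0n leqNgt => nk; rewrite /= /ext0 insubN//.
  by rewrite normr0 powR0 ?invr_eq0 ?gt_eqF.
rewrite add0n big_mkord -poweR_EFin; congr (_ `^ _)%E.
rewrite -sumEFin; apply: eq_bigr => i _ /=.
by rewrite /ext0 valK.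
Qed.

Let normD (x y : ell_fin) : norm (x + y) <= norm x + norm y.
Proof.
have aux (a b c : R) (A B C : \bar R) : a%:E = A -> b%:E = B -> c%:E = C ->
  (C <= A + B)%E -> c <= a + b by move=> <- <- <-; rewrite -EFinD lee_fin.
apply: aux (normE x) (normE y) (normE (x + y)) _.
rewrite [X in 'N[_]_ _[_ \o X]%E](_ : _ = ext0 x \+ ext0 y).
  exact: minkowski_EFin.
apply/funext => k; rewrite /ext0 /=.
by case: insub => [i|]; rewrite ?mxE ?addr0.
Qed.

Let normZ (a : R) (x : ell_fin) : norm (a *: x) = `|a| * norm x.
Proof.
have pV : p * p^-1 = 1 by rewrite mulfV// gt_eqF.
rewrite /norm -[in RHS](@powRr1 _ `|a|)// -pV powRrM -powRM ?powR_ge0//.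
  congr (_ `^ _); rewrite mulr_sumr; apply: eq_bigr => i _.
  by rewrite mxE normrM powRM.
by apply: sumr_ge0 => i _; exact: powR_ge0.
Qed.

Let norm_eq0 (x : ell_fin) : norm x = 0 -> x = 0.
Proof.
move=> /eqP; rewrite powR_eq0 => /andP[/eqP + _].
move=> /psumr_eq0P x0; apply/rowP => i; rewrite mxE.
have /eqP := x0 (fun i _ => powR_ge0 _ _) i erefl.
by rewrite powR_eq0 normr_eq0 => /andP[/eqP].
Qed.

HB.instance Definition _ := @Lmodule_isNormed.Build R ell_fin
  norm normD normZ norm_eq0.

Lemma ell_fin_normE (x : ell_fin) :
  `|x| = (\sum_(i < n) `|(x : 'rV[R]_n) 0 i| `^ p) `^ p^-1.
Proof. by []. Qed.

End ell_fin.

(* Main.v *)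
Require Import Defs.
From HB Require Import structures.
From mathcomp Require Import all_boot all_order all_algebra.
From mathcomp Require Import all_classical all_reals all_analysis.
From mathcomp Require Import ring lra.

(** Write spow r x = sgn(x) |x|^r and r = p - 1, so that spow r applied to the
    coordinates of x is, up to scaling, the functional norming x. Both sides of
    the equivalence turn out to say that some projection P onto Y is
    bi-contractive; the two isometries come for free from the shape that such a P
    must have.

    Shape of P. Let K be the kernel of P. Contractivity of P makes every v in Y
    Birkhoff orthogonal to every z in K, and contractivity of I - P makes every z
    in K Birkhoff orthogonal to every v in Y. Since p > 1 the norm is smooth, and
    each orthogonality becomes an equation ([birkhoff_orthogonal]): the sum of
    spow r (v q) * z q, respectively of spow r (z q) * v q, is 0. Choose a basis
    y of Y and indices k with y i (k j) = 1 if i = j and 0 otherwise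
    ([coordinate_basis]). For any index l, the n + 1 coordinate vectors at l and
    at the k i are dependent modulo K, and the first equation identifies the
    dependency ([zeta_ker]). Testing it on combinations of the y i gives
    identities such as 2^r = 1 + 1, impossible as r is not 1. Hence the y i have
    disjoint supports ([disjoint_supports]), and the second equation shows that
    their nonzero coordinates are 1 or -1 and that each support has at most two
    elements ([norm_coord1], [at_most_two]). So each y i is e_(k i) or
    e_(k i) + e_(l i) or e_(k i) - e_(l i): Y is isometric to l_p(n), while K is
    given by the equations z (k i) + e i * z (l i) = 0 ([kerP]) and is isometric to
    l_p after weighting the coordinates ([coupled_isometry]).

    From property (HB) to P. The G-components of the coordinate functionals at the
    k i form the dual basis of y in G, which defines P. The two inequalities of the
    property say that f o P and f o (I - P) have norm at most |f|, and testing on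
    norming functionals transfers this to P and I - P ([HB_projection]).

    From P to property (HB). Take for G the functionals f with f o P = f. Only the
    strict inequality needs an argument: if |f o P| = |f| > 0, then f attains its norm
    at a unit vector of Y, which is Birkhoff orthogonal to K, and smoothness forces
    f to vanish on K ([projection_HB]). *)

Set Implicit Arguments.
Unset Strict Implicit.
Unset Printing Implicit Defensive.
Import Order.TTheory GRing.Theory Num.Theory.
Import numFieldNormedType.Exports.

Local Open Scope classical_set_scope.
Local Open Scope ring_scope.

(** * Signed powers and the derivative of |x| ^ p *)

Section scalar.
Context {R : realType}.
Implicit Types (a b r p x : R).

Definition spow r x := Num.sg x * `|x| `^ r.

Lemma spow0 r : spow r 0 = 0.
Proof. by rewrite /spow sgr0 mul0r. Qed.

Lemma spow1 r : spow r 1 = 1.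
Proof. by rewrite /spow sgr1 normr1 powR1 mul1r. Qed.

Lemma spow_abs1 r x : `|x| = 1 -> spow r x = x.
Proof. by rewrite /spow => x1; rewrite x1 powR1 mulr1 [RHS]numEsg x1 mulr1. Qed.

Lemma spowN r x : spow r (- x) = - spow r x.
Proof. by rewrite /spow sgrN normrN mulNr. Qed.

Lemma gt0_spow r x : 0 < x -> spow r x = x `^ r.
Proof. by move=> x0; rewrite /spow gtr0_sg// gtr0_norm// mul1r. Qed.

Lemma spow_eq0 r x : (spow r x == 0) = (x == 0).
Proof.
rewrite /spow mulf_eq0 sgr_eq0 powR_eq0 normr_eq0.
by case: (x == 0).
Qed.

Lemma norm_spow r x : x != 0 -> `|spow r x| = `|x| `^ r.
Proof.
move=> x0; rewrite /spow normrM normr_sg x0 mul1r ger0_norm//.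
Qed.

Lemma spowM r x y : spow r (x * y) = spow r x * spow r y.
Proof. by rewrite /spow sgrM normrM powRM//; ring. Qed.

Lemma spow_mulr r x : 0 < r -> spow r x * x = `|x| `^ (r + 1).
Proof.
move=> r0; have [->|x0] := eqVneq x 0.
  by rewrite mulr0 normr0 powR0// gt_eqF// addr_gt0.
rewrite powRD; last by rewrite normr_eq0 x0 implybT.
rewrite powRr1// /spow mulrAC mulrC; congr (_ * _).
by rewrite normrEsg.
Qed.

Lemma spow_spow r s x : spow r (spow s x) = spow (s * r) x.
Proof.
rewrite /spow; have [->|x0] := eqVneq x 0; first by rewrite sgr0 !mul0r sgr0 mul0r.
rewrite sgrM sgr_id (@gtr0_sg _ (_ `^ _)) ?mulr1 ?powR_gt0 ?normr_gt0//.
rewrite normrM normr_sg x0 mul1r; congr (_ * _).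
by rewrite ger0_norm ?powR_ge0// powRrM.
Qed.

Lemma spow_exp1 x : spow 1 x = x.
Proof. by rewrite /spow powRr1// [RHS]numEsg. Qed.

Lemma powR_le_inv p a b : 0 < p -> 0 <= a -> 0 <= b -> a `^ p <= b `^ p -> a <= b.
Proof.
move=> p0 a0 b0; rewrite leNgt => ab; rewrite leNgt; apply: contra ab => ba.
by apply: gt0_ltr_powR; rewrite ?nnegrE.
Qed.

Lemma sum_powR_normalised p (I : finType) (u : I -> R) :
  0 < p -> 0 < \sum_i `|u i| `^ p ->
  \sum_i `|u i / (\sum_j `|u j| `^ p) `^ p^-1| `^ p = 1.
Proof.
move=> p0; set s := \sum_j _ => s0.
set c := s `^ p^-1; have c0 : 0 < c by rewrite powR_gt0.
have cp : c `^ p = s by rewrite -powRrM mulVf ?gt_eqF// powRr1// ltW.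
under eq_bigr do rewrite normrM powRM// normfV (gtr0_norm c0).
rewrite -mulr_suml -(powR_inv1 (ltW c0)) -powRrM mulN1r powRN cp.
by rewrite divff// gt_eqF.
Qed.

Lemma powR2_eq2 r : (2 : R) `^ r = 2 -> r = 1.
Proof.
move=> h.
have : ln ((2 : R) `^ r) = ln 2 by rewrite h.
rewrite ln_powR -[RHS]mul1r => /mulIf; apply.
by rewrite gt_eqF// ln_gt0// ltr1n.
Qed.

(** For p > 1 the map x |-> |x| ^ p is differentiable even at 0, where its
    difference quotient is of size |h| ^ (p - 1). *)
Lemma is_derive_abs_powR p x : 1 < p ->
  is_derive x 1 (fun x => `|x| `^ p) (p * spow (p - 1) x).
Proof.
move=> p1.
have [x0|x0|->] := ltgtP x 0.
- have -> : p * spow (p - 1) x = (p * (- x) `^ (p - 1)) * (- 1).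
    by rewrite /spow ltr0_sg// ltr0_norm//; ring.
  apply: (@near_eq_is_derive _ _ _ (fun y => (- y) `^ p)).
  + by apply: filterS (lt_nbhsl x0) => y y0; rewrite ltr0_norm.
  + have H : is_derive (- x) 1 (@powR R ^~ p) (p * (- x) `^ (p - 1)).
      by apply: is_derive1_powR; rewrite oppr_gt0.
    have H2 : is_derive x 1 (-%R : R -> R) (- 1) by exact: is_deriveN.
    exact: is_derive1_comp H H2.
- rewrite /spow gtr0_sg// gtr0_norm// mul1r.
  apply: (@near_eq_is_derive _ _ _ (@powR R ^~ p)).
  + by apply: filterS (lt_nbhsr x0) => y y0; rewrite gtr0_norm.
  + exact: is_derive1_powR.
- rewrite spow0 mulr0.
  have H : (fun h : R => h^-1 *: (((fun x => `|x| `^ p) \o shift 0) (h *: 1) -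
      `|0 : R| `^ p)) @ 0^' --> (0 : R).
    apply/cvgrPdist_lt => e e0; near=> h.
    have h0 : h != 0 by near: h; exact: nbhs_dnbhs_neq.
    rewrite sub0r normrN /= addr0 normr0 powR0 ?subr0; last first.
      by rewrite gt_eqF// (lt_trans _ p1).
    rewrite /GRing.scale/= mulr1 normrM normfV (ger0_norm (powR_ge0 _ _)).
    have -> : `|h|^-1 * `|h| `^ p = `|h| `^ (p - 1).
      by rewrite powRB ?powRr1 1?mulrC// normr_eq0 (negbTE h0) implybT.
    have : `|h| < e `^ (p - 1)^-1.
      near: h; apply: dnbhs0_lt; exact: powR_gt0.
    move=> he; have p10 : p - 1 != 0 by rewrite subr_eq0 gt_eqF.
    have -> : e = (e `^ (p - 1)^-1) `^ (p - 1).
      by rewrite -powRrM mulVf// powRr1// ltW.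
    by apply: gt0_ltr_powR; rewrite ?nnegrE ?subr_gt0 ?powR_ge0.
  apply: DeriveDef; first by apply/cvg_ex; exists 0; exact: H.
  exact: cvg_lim H.
Unshelve. all: by end_near. Qed.

Lemma is_derive_abs_powR_line p a b (t : R) : 1 < p ->
  is_derive t 1 (fun t => `|a + t * b| `^ p)
    (p * (spow (p - 1) (a + t * b) * b)).
Proof.
move=> p1.
have H := is_derive_abs_powR (a + t * b) p1.
have H2 : is_derive t 1 (fun t => a + t * b) b.
  have -> : (fun t : R => a + t * b) = cst a + (fun t => b *: t).
    by apply/funext => u; rewrite /= /GRing.scale/= mulrC.
  have db : b = 0 + b *: 1 :> R by rewrite add0r /GRing.scale/= mulr1.
  by rewrite [X in is_derive _ _ _ X]db; apply: is_deriveD; exact: is_deriveZ.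
have := @is_derive1_comp _ _ (fun t => a + t * b) t _ _ H H2.
by rewrite -mulrA => h; exact: h.
Qed.

Lemma derive_at_global_min (f df : R -> R) :
  (forall t : R, is_derive t 1 f (df t)) -> (forall t, f 0 <= f t) -> df 0 = 0.
Proof.
move=> fdf f0.
have H : is_derive (0 : R) 1 f 0.
  apply: (@derive1_at_min _ _ (- 1) 1) => //.
  - by rewrite in_itv/= ltrN10 ltr01.
have [_ e1] := fdf 0; have [_ e2] := H.
by rewrite -e1 e2.
Qed.

End scalar.

(** * Operator norms and bounded functionals *)

Section generic.
Context {R : realType} {X : normedModType R}.

Lemma opnorm_le1P (f : X -> X) : (forall a x, f (a *: x) = a *: f x) ->
  (opnorm f <= 1)%E <-> forall x, `|f x| <= `|x|.
Proof.
move=> fZ; split=> [f1 x|f1]; last first.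
  by apply: opnorm_le => x x1; rewrite lee_fin (le_trans (f1 x)).
have [->|x0] := eqVneq x 0.
  by rewrite -[X in f X](scale0r (0 : X)) fZ scale0r normr0.
have nx : 0 < `|x| by rewrite normr_gt0.
have : ((`|f (`|x|^-1 *: x)|)%:E <= 1)%E.
  apply: le_trans f1; apply: opnorm_ge.
  by rewrite normrZ normfV normr_id mulVf// gt_eqF.
rewrite lee_fin fZ normrZ normfV normr_id mulrC ler_pdivrMr//.
by rewrite mul1r.
Qed.

Lemma dual_norm_opnorm (f : dual X) : (`|f|)%:E = opnorm f.
Proof.
rewrite dual_normE fineK// ge0_fin_numE ?opnorm_ge0//.
exact/opnorm_lty/dual_continuous.
Qed.

Lemma dual_bound (f : dual X) x : `|f x| <= `|f| * `|x|.
Proof.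
have [->|x0] := eqVneq x 0; first by rewrite linear0 !normr0 mulr0.
have nx : 0 < `|x| by rewrite normr_gt0.
have : ((`|f (`|x|^-1 *: x)|)%:E <= (`|f|)%:E)%E.
  rewrite dual_norm_opnorm; apply: opnorm_ge.
  by rewrite normrZ normfV normr_id mulVf// gt_eqF.
by rewrite lee_fin linearZ/= normrZ normfV normr_id mulrC ler_pdivrMr.
Qed.

Lemma dual_norm_le (f : dual X) M : 0 <= M ->
  (forall x, `|f x| <= M * `|x|) -> `|f| <= M.
Proof.
move=> M0 fM; rewrite -lee_fin dual_norm_opnorm; apply: opnorm_le => x x1; rewrite lee_fin.
by rewrite (le_trans (fM x))// ler_piMr.
Qed.

Lemma bounded_dual (f : X -> R) M : linear (f : X -> R^o) ->
  (forall x, `|f x| <= M * `|x|) -> exists d : dual X, forall x, d x = f x.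
Proof.
move=> lf fM.
pose fl := GRing.isLinear.Build R X R^o _ f lf.
pose F : {linear X -> R^o} := HB.pack (f : X -> R^o) fl.
suff cf : continuous (f : X -> R^o).
  have fP : (f : X -> R^o) \in @dual_pred R X by rewrite inE.
  by exists (Dual fP).
apply: (@bounded_linear_continuous _ _ _ F).
by apply/linear_boundedP; near=> k => x; apply: (le_trans (fM x));
  apply: ler_wpM2r => //; near: k; exact: nbhs_pinfty_ge.
Unshelve. all: by end_near. Qed.

End generic.

(** * The space l_p in coordinates *)

Arguments ell_fun : simpl never.

Section ell_basics.
Context {R : realType} {p : R} (p1 : 1 < p).
Local Notation E := (ell (ltW p1)).
Implicit Types x y z h : E.

Let p0 : 0 < p. Proof. exact: lt_trans p1. Qed.

Lemma ell_ext x y : (forall k : nat, x k = y k) -> x = y.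
Proof. by move=> xy; apply/val_inj/funext => k; exact: xy. Qed.

Lemma ell0 k : ell_fun (0 : E) k = 0. Proof. by []. Qed.
Lemma ellD x y k : ell_fun (x + y) k = x k + y k. Proof. by []. Qed.
Lemma ellN x k : ell_fun (- x) k = - x k. Proof. by []. Qed.
Lemma ellB x y k : ell_fun (x - y) k = x k - y k. Proof. by []. Qed.
Lemma ellZ a x k : ell_fun (a *: x) k = a * x k. Proof. by []. Qed.
Lemma ell_sum I (r : seq I) (P : pred I) (F : I -> E) k :
  ell_fun (\sum_(i <- r | P i) F i) k = \sum_(i <- r | P i) ell_fun (F i) k.
Proof. by elim/big_ind2 : _ => // a x b y <- <-; rewrite ellD. Qed.

Definition ellE := (ell0, ellD, ellN, ellB, ellZ, ell_sum).

Lemma ell_normpE x :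
  ((`|x| `^ p)%:E = \sum_(k <oo) (`|x k| `^ p)%:E)%E.
Proof.
rewrite -poweR_EFin ell_normE -poweRrM mulVf ?poweRe1 ?gt_eqF//.
by apply: nneseries_ge0 => k _ _; rewrite lee_fin powR_ge0.
Qed.

Lemma ell_mk (x : nat -> R) :
  (\sum_(k <oo) (`|x k| `^ p)%:E < +oo)%E -> exists e : E, forall k, e k = x k.
Proof.
move=> xoo.
have xL : x \in @Lfun _ _ R (@counting nat R) p%:E.
  rewrite inE; apply/andP; split; first by rewrite inE.
  rewrite inE /= /finite_norm Lnorm_counting//.
  by apply: poweR_lty.
by exists (@Lfun_Sub _ _ _ _ _ (ltW p1 : (1 <= p%:E)%E) x xL).
Qed.

Lemma ell_split x m : exists2 T, 0 <= T &
  `|x| `^ p = \sum_(k < m) `|x k| `^ p + T.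
Proof.
have x0 k : (0 <= (`|x k| `^ p)%:E)%E by rewrite lee_fin powR_ge0.
have := ell_normpE x.
rewrite (nneseries_split 0 m)// add0n big_mkord sumEFin.
have : (0 <= \sum_(m <= k <oo) (`|x k| `^ p)%:E)%E.
  exact: nneseries_ge0.
case: (\sum_(m <= k <oo) _)%E => [T|//|//]; rewrite lee_fin => T0 [->].
by exists T.
Qed.

Lemma ell_coord_le x k : `|x k| <= `|x|.
Proof.
have [T T0 xE] := ell_split x k.+1.
apply: (powR_le_inv p0) => //.
rewrite xE big_ord_recr/= -addrA addrCA lerDl addr_ge0//.
by apply: sumr_ge0 => i _; exact: powR_ge0.
Qed.

(** Outside the first m coordinates x and h never overlap, so that the infinite
    tail of the p-th power of the norm contributes only A + |t| ^ p B, and no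
    differentiation of infinite sums is ever required. *)
Lemma normp_line_split x h m : (forall k, (m <= k)%N -> x k * h k = 0) ->
  exists A B, `|h| `^ p = \sum_(k < m) `|h k| `^ p + B /\
    forall t, `|x + t *: h| `^ p =
      \sum_(k < m) `|x k + t * h k| `^ p + A + `|t| `^ p * B.
Proof.
move=> xh.
have [A A0 xE] := ell_split x m; have [B B0 hE] := ell_split h m.
exists A, B; split=> // t.
have pos (y : E) k : (0 <= (`|y k| `^ p)%:E)%E by rewrite lee_fin powR_ge0.
apply: EFin_inj.
rewrite ell_normpE (nneseries_split 0 m)// add0n big_mkord sumEFin.
rewrite -addrA EFinD; congr (_ + _)%E.
have tl (y : E) T : `|y| `^ p = \sum_(k < m) `|y k| `^ p + T ->
    (\sum_(m <= k <oo) (`|y k| `^ p)%:E)%E = T%:E.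
  move=> yE; have := ell_normpE y.
  rewrite (nneseries_split 0 m)// add0n big_mkord sumEFin yE EFinD.
  case: (\sum_(m <= k <oo) _)%E => [s|//|//] [] /addrI ->//.
rewrite EFinD EFinM -(tl _ _ xE) -(tl _ _ hE) -nneseriesZl//.
rewrite -nneseriesD//.
  rewrite eseries_cond [RHS]eseries_cond; apply: eq_eseriesr => k /andP[_ mk].
  rewrite -EFinM -EFinD; congr (_%:E).
  have /eqP := xh k mk; rewrite mulf_eq0 => /orP[]/eqP e0.
    by rewrite !ellE e0 add0r normr0 powR0 ?gt_eqF// add0r normrM powRM.
  by rewrite !ellE e0 mulr0 addr0 normr0 powR0 ?gt_eqF// mulr0 addr0.
Qed.

Lemma normp_disjointD x h : (forall k, x k * h k = 0) ->
  `|x + h| `^ p = `|x| `^ p + `|h| `^ p.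
Proof.
move=> xh; have [A [B [hE xhE]]] := @normp_line_split x h 0 (fun k _ => xh k).
rewrite !big_ord0 add0r in hE.
have := xhE 0; have := xhE 1.
rewrite !big_ord0 scale1r scale0r addr0 normr1 normr0 powR1 powR0 ?gt_eqF//.
by rewrite mul0r mul1r add0r addr0 hE => -> ->.
Qed.

Lemma normp_disjoint_sum n (y : 'I_n -> E) (a : 'I_n -> R) :
  (forall i j k, i != j -> ell_fun (y i) k * ell_fun (y j) k = 0) ->
  `|\sum_i a i *: y i| `^ p = \sum_i `|a i| `^ p * `|y i| `^ p.
Proof.
move=> yy; elim: (index_enum _) (index_enum_uniq 'I_n) => [|i s IH] /=.
  by rewrite !big_nil normr0 powR0// gt_eqF.
move=> /andP[si us]; rewrite !big_cons normp_disjointD ?IH//.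
  by rewrite normrZ powRM.
move=> k; rewrite ellZ ell_sum mulr_sumr big_seq big1// => j js.
rewrite ellZ mulrACA yy ?mulr0//.
by apply: contraNneq si => ->.
Qed.

Lemma ell_norm_powP x y : `|x| `^ p = `|y| `^ p -> `|x| = `|y|.
Proof.
move=> xy; apply/eqP.
by rewrite eq_le; apply/andP; split; apply: (powR_le_inv p0); rewrite ?xy.
Qed.

(** This is Hoelder's inequality on the unit sphere; adding up Young's inequality
    over the coordinates proves it. *)
Lemma young_sum m (u x : 'I_m -> R) :
  \sum_i `|u i| `^ p <= 1 -> \sum_i `|x i| `^ p <= 1 ->
  \sum_i spow (p - 1) (u i) * x i <= 1.
Proof.
move=> u1 x1.
have r0 : 0 < p - 1 by rewrite subr_gt0.
pose q := p / (p - 1).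
have q0 : 0 < q by rewrite divr_gt0.
have pq : p^-1 + q^-1 = 1.
  by rewrite /q; field; rewrite !gt_eqF.
have H i : spow (p - 1) (u i) * x i <= `|x i| `^ p / p + `|u i| `^ p / q.
  apply: (le_trans (ler_norm _)); rewrite normrM mulrC.
  have [u0|u0] := eqVneq (u i) 0.
    by rewrite u0 spow0 normr0 mulr0 addr_ge0// divr_ge0 ?powR_ge0// ltW.
  rewrite norm_spow//.
  have -> : `|u i| `^ p = (`|u i| `^ (p - 1)) `^ q.
    by rewrite -powRrM /q mulrCA divff ?mulr1// gt_eqF.
  by apply: conjugate_powR => //; exact: powR_ge0.
apply: (le_trans (ler_sum _ (fun i _ => H i))).
rewrite big_split/= -!mulr_suml -[leRHS]pq.
by apply: lerD; rewrite -[leRHS]mul1r ler_wpM2r// invr_ge0 ltW.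
Qed.

End ell_basics.

(** * Birkhoff orthogonality and smoothness *)

Section birkhoff.
Context {R : realType} {p : R} (p1 : 1 < p).
Local Notation E := (ell (ltW p1)).
Implicit Types x y z h : E.

Let p0 : 0 < p. Proof. exact: lt_trans p1. Qed.

Lemma is_derive_normp_line x h m : (forall k, (m <= k)%N -> x k * h k = 0) ->
  exists B, forall t : R, is_derive t 1 (fun t : R => `|x + t *: h| `^ p)
    (p * (\sum_(k < m) spow (p - 1) (x k + t * h k) * h k +
          spow (p - 1) t * B)).
Proof.
move=> xh; have [A [B [_ xhE]]] := normp_line_split xh.
exists B => t.
have -> : (fun t : R => `|x + t *: h| `^ p) =
    (\sum_(k < m) (fun t : R => `|x k + t * h k| `^ p)) +
    (cst A + (fun t : R => B *: `|t| `^ p)).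
  apply/funext => u; rewrite xhE -addrA; congr (_ + _).
    by rewrite fct_sumE.
  by rewrite /= /GRing.scale/= mulrC.
have -> : p * (\sum_(k < m) spow (p - 1) (x k + t * h k) * h k +
               spow (p - 1) t * B) =
    \sum_(k < m) (p * (spow (p - 1) (x k + t * h k) * h k)) +
    (0 + B *: (p * spow (p - 1) t)).
  by rewrite add0r mulrDr mulr_sumr /GRing.scale/=; congr (_ + _); ring.
apply: is_deriveD.
  apply: is_derive_sum => k. exact: (is_derive_abs_powR_line _ _ _ p1).
apply: is_deriveD; apply: is_deriveZ; exact: is_derive_abs_powR.
Qed.

(** If the norm does not decrease in the direction h, then t = 0 minimises
    |x + t h| ^ p, and the derivative there is p times the stated sum: the
    pairing of h with the functional dual to x. *)
Lemma birkhoff_orthogonal x h m : (forall k, (m <= k)%N -> x k * h k = 0) ->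
  (forall t, `|x| <= `|x + t *: h|) ->
  \sum_(k < m) spow (p - 1) (x k) * h k = 0.
Proof.
move=> xh min0; have [B D] := is_derive_normp_line xh.
have := derive_at_global_min D.
rewrite spow0 mul0r addr0 scale0r addr0.
have mono t : `|x| `^ p <= `|x + t *: h| `^ p.
  by apply: ge0_ler_powR; rewrite ?nnegrE// ltW.
move=> /(_ mono)/eqP; rewrite mulf_eq0 gt_eqF//= => /eqP e0; rewrite -[RHS]e0.
by apply: eq_bigr => k _; rewrite mul0r addr0.
Qed.

(** Smoothness of the norm: (|f| |x + t h|) ^ p dominates |f (x + t h)| ^ p with
    equality at t = 0, so the two functions of t share their derivative there, and
    for the former it vanishes by Birkhoff orthogonality. *)
Lemma support_functional_orthogonal (f : dual E) x h m :
  (forall k, (m <= k)%N -> x k * h k = 0) ->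
  (forall t, `|x| <= `|x + t *: h|) ->
  `|x| = 1 -> f x = `|f| -> f h = 0.
Proof.
move=> xh min0 x1 fx.
have bo := birkhoff_orthogonal xh min0.
have [B D] := is_derive_normp_line xh.
have [f0|f0] := eqVneq `|f| 0.
  have := dual_bound f h; rewrite f0 mul0r normr_le0 => /eqP//.
pose N := `|f|; have N0 : 0 < N by rewrite lt_neqAle eq_sym f0 normr_ge0.
pose g t : R := (N `^ p) *: `|x + t *: h| `^ p - `|N + t * f h| `^ p.
have Dg (t : R) : is_derive t 1 g
    ((N `^ p) *: (p * (\sum_(k < m) spow (p - 1) (x k + t * h k) * h k +
                       spow (p - 1) t * B)) -
     p * (spow (p - 1) (N + t * f h) * f h)).
  apply: is_deriveB.
  exact: is_derive_abs_powR_line.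
have := derive_at_global_min Dg.
have -> : \sum_(k < m) spow (p - 1) (x k + 0 * h k) * h k = 0.
  by rewrite -[RHS]bo; apply: eq_bigr => k _; rewrite mul0r addr0.
rewrite spow0 mul0r !addr0 mulr0 scaler0 sub0r mul0r addr0.
move=> H.
have /H/eqP : forall t, g 0 <= g t.
  move=> t; rewrite /g scale0r mul0r !addr0 x1 powR1 /GRing.scale/= mulr1.
  rewrite gtr0_norm// subrr.
  rewrite subr_ge0 -powRM ?(ltW N0)//.
  apply: ge0_ler_powR; rewrite ?nnegrE ?mulr_ge0 ?(ltW N0) ?(ltW p0)//.
  have -> : N + t * f h = f (x + t *: h) by rewrite linearD linearZ/= fx.
  exact: dual_bound.
rewrite oppr_eq0 mulf_eq0 (gt_eqF p0)/= mulf_eq0 spow_eq0 (gt_eqF N0)/=.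
by move=> /eqP.
Qed.

End birkhoff.

(** * Finitely supported sequences *)

Section finsupp.
Context {R : realType} {p : R} (p1 : 1 < p).
Local Notation E := (ell (ltW p1)).

Let p0 : 0 < p. Proof. exact: lt_trans p1. Qed.

Lemma ell_mk_finsupp (x : nat -> R) m : (forall k, (m <= k)%N -> x k = 0) ->
  exists e : E, forall k, e k = x k.
Proof.
move=> xm; apply: ell_mk.
rewrite (nneseries_split 0 m); last by move=> k _; rewrite lee_fin powR_ge0.
rewrite add0n eseries0; first by rewrite adde0 sumEFin ltry.
by move=> k mk _ /=; rewrite xm// normr0 powR0// gt_eqF.
Qed.

Lemma ell_delta_ex j : exists e : E, forall k, e k = (k == j)%:R.
Proof.
by apply: (@ell_mk_finsupp _ j.+1) => k jk; rewrite gtn_eqF.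
Qed.

Definition ell_delta j : E := sval (cid (ell_delta_ex j)).

Lemma ell_deltaE j k : ell_fun (ell_delta j) k = (k == j)%:R.
Proof. by rewrite /ell_delta; case: cid. Qed.

Lemma big_ord_supp (s : seq nat) m (F : nat -> R) : uniq s ->
  (forall q, q \in s -> (q < m)%N) -> (forall q, q \notin s -> F q = 0) ->
  \sum_(q < m) F q = \sum_(q <- s) F q.
Proof.
move=> us sm F0; rewrite -(big_mkord xpredT).
rewrite (bigID (mem s))/= [X in _ + X]big1 ?addr0; last by move=> q; exact: F0.
rewrite -big_filter; apply: perm_big; apply: uniq_perm => //.
  by rewrite filter_uniq ?iota_uniq.
move=> q; rewrite mem_filter mem_index_iota/=.
by case: (boolP (q \in s)) => //= /sm ->.
Qed.

Lemma sum_delta m (g : nat -> R) j : (j < m)%N ->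
  \sum_(q < m) g q * ell_fun (ell_delta j) q = g j.
Proof.
move=> jm; rewrite (@big_ord_supp [:: j] m (fun q => g q * ell_fun (ell_delta j) q))//=.
- by rewrite big_seq1 ell_deltaE eqxx mulr1.
- by move=> q; rewrite inE => /eqP->.
- by move=> q; rewrite inE ell_deltaE => /negbTE ->; rewrite mulr0.
Qed.

End finsupp.

(** * The shape of a bi-contractive projection of finite rank *)

Section bicontractive.
Context {R : realType} {p : R} (p1 : 1 < p) (pn2 : p != 2).
Local Notation E := (ell (ltW p1)).
Context (n : nat) (y : 'I_n -> E) (k : 'I_n -> nat) (P : {linear E -> E}).
Context (yk : forall i j, ell_fun (y i) (k j) = (i == j)%:R).
Context (Py : forall i, P (y i) = y i).
Context (Pspan : forall x : E, exists a : 'I_n -> R, P x = \sum_i a i *: y i :> E).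
Context (P1 : forall x : E, `|P x| <= `|x|) (Q1 : forall x : E, `|x - P x| <= `|x|).
Implicit Types x v z : E.

Let p0 : 0 < p. Proof. exact: lt_trans p1. Qed.
Let r := p - 1.
Let r0 : 0 < r. Proof. by rewrite subr_gt0. Qed.
Let rn1 : r != 1.
Proof. by apply: contra pn2 => /eqP h; rewrite -[p](subrK 1) -/r h. Qed.
Local Notation delta := (@ell_delta R p p1).

Lemma P_idem x : P (P x) = P x.
Proof.
have [a ->] := Pspan x; rewrite linear_sum/=; apply: eq_bigr => i _.
by rewrite linearZ/= Py.
Qed.

Lemma P_coord x : P x = \sum_i ell_fun (P x) (k i) *: y i.
Proof.
have [a xE] := Pspan x; rewrite {1}xE; apply: eq_bigr => i _; congr (_ *: _).
rewrite xE ell_sum (bigD1 i)//= ellZ yk eqxx mulr1 big1 ?addr0// => j ji.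
by rewrite ellZ yk (negbTE ji) mulr0.
Qed.

Lemma range_ortho v z t : P v = v -> P z = 0 -> `|v| <= `|v + t *: z|.
Proof.
move=> vv zz; rewrite -{1}vv; have -> : P v = P (v + t *: z).
  by rewrite linearD linearZ/= zz scaler0 addr0.
exact: P1.
Qed.

Lemma ker_ortho v z t : P v = v -> P z = 0 -> `|z| <= `|z + t *: v|.
Proof.
move=> vv zz; have e : (z + t *: v) - P (z + t *: v) = z :> E.
  by rewrite linearD linearZ/= zz vv add0r addrK.
by rewrite -{1}e; exact: Q1.
Qed.

Lemma ker_pairing_range v z m : P v = v -> P z = 0 ->
  (forall q, (m <= q)%N -> v q * z q = 0) ->
  \sum_(q < m) spow r (v q) * z q = 0.
Proof.
by move=> vv zz vz; apply: birkhoff_orthogonal => // t; exact: range_ortho.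
Qed.

Lemma range_pairing_ker v z m : P v = v -> P z = 0 ->
  (forall q, (m <= q)%N -> v q * z q = 0) ->
  \sum_(q < m) spow r (z q) * v q = 0.
Proof.
move=> vv zz vz; apply: birkhoff_orthogonal => [q /vz|t].
  by rewrite mulrC.
exact: ker_ortho.
Qed.

(** The vector e_l corrected by the coordinate vectors e_(k i) so as to be
    annihilated by the functionals dual to the y i. *)
Definition zeta l : E := delta l - \sum_i spow r (ell_fun (y i) l) *: delta (k i).

Let bnd l := (l + \sum_i k i).+1.

Let ki_bnd l i : (k i < bnd l)%N.
Proof. by rewrite /bnd ltnS (bigD1 i)//= addnCA leq_addr. Qed.

Let l_bnd l : (l < bnd l)%N. Proof. by rewrite /bnd ltnS leq_addr. Qed.

Lemma zetaE l q : ell_fun (zeta l) q =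
  (q == l)%:R - \sum_i spow r (ell_fun (y i) l) * (q == k i)%:R.
Proof.
rewrite /zeta ellB ell_deltaE ell_sum; congr (_ - _); apply: eq_bigr => i _.
by rewrite ellZ ell_deltaE.
Qed.

Lemma zeta_pair l m (g : nat -> R) : (bnd l <= m)%N ->
  \sum_(q < m) g q * ell_fun (zeta l) q =
  g l - \sum_i spow r (ell_fun (y i) l) * g (k i).
Proof.
move=> lm.
under eq_bigr do rewrite zetaE mulrBr -(ell_deltaE p1).
rewrite sumrB sum_delta ?(leq_trans _ lm)//; congr (_ - _).
under eq_bigr do rewrite mulr_sumr.
rewrite exchange_big/=; apply: eq_bigr => i _.
under eq_bigr do rewrite mulrCA -(ell_deltaE p1).
by rewrite -mulr_sumr sum_delta// (leq_trans _ lm).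
Qed.

(** P maps the n + 1 vectors e_(k i), e_l into an n-dimensional space, so some
    nontrivial combination of them lies in the kernel. Orthogonality to each y i
    forces the coefficient of e_(k i) in it to be that of zeta l, up to scaling. *)
Lemma zeta_ker l : P (zeta l) = 0.
Proof.
pose pt (s : 'I_n.+1) : nat := if unlift ord_max s is Some i then k i else l.
pose M := \matrix_(s < n.+1, i < n) ell_fun (P (delta (pt s))) (k i).
have : exists2 u : 'rV[R]_n.+1, u != 0 & u *m M = 0.
  have : kermx M != 0.
    by rewrite -mxrank_eq0 mxrank_ker -lt0n subn_gt0 ltnS rank_leq_col.
  move=> /rowV0Pn[u /sub_kermxP uM u0]; by exists u.
move=> [u u0 uM].
pose z : E := \sum_s u 0 s *: delta (pt s).
have Pz : P z = 0.
  rewrite P_coord big1// => i _.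
  suff -> : ell_fun (P z) (k i) = 0 by rewrite scale0r.
  have := congr1 (fun A : 'rV_n => A 0 i) uM; rewrite !mxE => <-.
  rewrite linear_sum/= ell_sum; apply: eq_bigr => s _.
  by rewrite linearZ/= ellZ mxE.
have zE : z = u 0 ord_max *: delta l + \sum_i u 0 (lift ord_max i) *: delta (k i).
  rewrite /z (bigD1_ord ord_max)//= /pt unlift_none; congr (_ + _).
  by apply: eq_bigr => i _; rewrite liftK.
have ui i : u 0 (lift ord_max i) = - u 0 ord_max * spow r (ell_fun (y i) l).
  have : \sum_(q < bnd l) spow r (ell_fun (y i) q) * z q = 0.
    apply: ker_pairing_range => // q lq.
    suff -> : ell_fun z q = 0 by rewrite mulr0.
    rewrite zE !ellE ell_deltaE gtn_eqF ?(leq_trans _ lq)// mulr0 add0r.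
    by rewrite big1// => j _; rewrite ellZ ell_deltaE gtn_eqF ?(leq_trans _ lq)// mulr0.
  under eq_bigr do rewrite zE !ellE mulrDr mulr_sumr mulrCA.
  rewrite big_split/= -mulr_sumr (sum_delta p1 (fun q => spow r (ell_fun (y i) q)))//.
  rewrite exchange_big/=.
  rewrite (bigD1 i)//= [X in _ + (_ + X)]big1 => [|j ji]; last first.
    under eq_bigr do rewrite ellZ mulrCA.
    rewrite -mulr_sumr (sum_delta p1 (fun q => spow r (ell_fun (y i) q)))//.
    by rewrite yk eq_sym (negbTE ji) spow0 mulr0.
  under eq_bigr do rewrite ellZ mulrCA.
  rewrite -mulr_sumr (sum_delta p1 (fun q => spow r (ell_fun (y i) q)))//.
  rewrite yk eqxx spow1 mulr1 addr0 => /eqP.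
  by rewrite addrC addr_eq0 => /eqP->; rewrite mulNr.
have um : u 0 ord_max != 0.
  apply: contra u0 => /eqP um; apply/eqP/rowP => s; rewrite mxE.
  by case: (unliftP ord_max s) => [i|] ->; rewrite ?ui um ?oppr0 ?mul0r.
have : z = u 0 ord_max *: zeta l.
  rewrite zE /zeta scalerBr scaler_sumr -sumrN; congr (_ + _).
  by apply: eq_bigr => i _; rewrite ui scalerA -scaleNr mulNr.
move=> {}zE; move: Pz; rewrite zE linearZ/= => /eqP.
by rewrite scaler_eq0 (negbTE um)/= => /eqP.
Qed.

Lemma zeta_supp l q : (bnd l <= q)%N -> ell_fun (zeta l) q = 0.
Proof.
move=> lq; rewrite zetaE gtn_eqF ?(leq_trans _ lq)// big1 ?subr0// => i _.
by rewrite gtn_eqF ?(leq_trans _ lq)// mulr0.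
Qed.

Let two_r : (2 : R) `^ r != 2.
Proof. by apply/eqP => /powR2_eq2 /eqP; exact/negP. Qed.

(** If y i and y j took nonzero values c and d at l, pairing the functional dual to
    y i / c + y j / d with zeta l would give 2 ^ (p - 1) = 1 + 1, hence p = 2. *)
Lemma disjoint_supports i j l :
  i != j -> ell_fun (y i) l != 0 -> ell_fun (y j) l = 0.
Proof.
move=> ij c0; apply/eqP; apply: contraT => d0.
set c := ell_fun (y i) l in c0; set d := ell_fun (y j) l in d0.
pose v : E := c^-1 *: y i + d^-1 *: y j.
have Pv : P v = v by rewrite linearD !linearZ/= !Py.
have := ker_pairing_range Pv (zeta_ker l) (m := bnd l).
rewrite (zeta_pair (fun q => spow r (v q)))//.
have -> : ell_fun v l = 2.
  by rewrite /v !ellE mulVf// mulVf.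
rewrite (bigD1 i)//= (bigD1 j) 1?eq_sym//= big1 => [|s /andP[si sj]]; last first.
  rewrite /v !ellE !yk ![_ == s]eq_sym (negbTE si) (negbTE sj).
  by rewrite !mulr0 addr0 spow0 mulr0.
rewrite /v !ellE !yk !eqxx (negbTE ij) eq_sym (negbTE ij) !mulr0 !mulr1 addr0 add0r.
rewrite -!spowM -/c -/d !divff// !spow1 addr0 gt0_spow// => H.
have tl0 : forall q, (bnd l <= q)%N -> ell_fun v q * ell_fun (zeta l) q = 0.
  by move=> q lq; rewrite zeta_supp// mulr0.
have /eqP := H tl0.
by rewrite subr_eq0 (negbTE two_r).
Qed.

Lemma zeta2 i l : ell_fun (y i) l != 0 ->
  zeta l = delta l - spow r (ell_fun (y i) l) *: delta (k i).
Proof.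
move=> c0; rewrite /zeta (bigD1 i)//= big1 ?addr0// => j ji.
by rewrite (disjoint_supports _ c0) 1?eq_sym// spow0 scale0r.
Qed.

(** Exchanging the roles of range and kernel: the functional dual to
    zeta l = e_l - c ^ (p - 1) e_(k i), where c is the value of y i at l and powers
    keep the sign, kills y i. This reads c = c ^ ((p - 1) ^ 2), and the exponent is
    not 1. *)
Lemma norm_coord1 i l : ell_fun (y i) l != 0 -> `|ell_fun (y i) l| = 1.
Proof.
move=> c0; have [lk|lk] := eqVneq l (k i); first by rewrite lk yk eqxx normr1.
have := range_pairing_ker (Py i) (zeta_ker l) (m := bnd l).
rewrite (@big_ord_supp R [:: l; k i] _
  (fun q => spow r (ell_fun (zeta l) q) * ell_fun (y i) q)); first last.
- move=> q; rewrite !inE negb_or => /andP[ql qk].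
  rewrite (zeta2 c0) !ellE !ell_deltaE (negbTE ql) (negbTE qk) mulr0 subr0.
  by rewrite spow0 mul0r.
- by move=> q; rewrite !inE => /orP[]/eqP->.
- by rewrite /= inE lk.
rewrite big_cons big_seq1 (zeta2 c0) !ellE !ell_deltaE !eqxx (negbTE lk).
rewrite eq_sym (negbTE lk) mulr0 subr0 spow1 mul1r mulr1 sub0r spowN yk eqxx mulr1.
rewrite -(zeta2 c0) => H.
have tl0 : forall q, (bnd l <= q)%N -> ell_fun (y i) q * ell_fun (zeta l) q = 0.
  by move=> q lq; rewrite zeta_supp// mulr0.
have /eqP := H tl0.
rewrite spow_spow subr_eq0 => /eqP /(congr1 Num.norm).
rewrite norm_spow//; set a := `|_| => ha.
have a0 : 0 < a by rewrite normr_gt0.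
have rr1 : r * r - 1 != 0.
  rewrite subr_eq0; apply: contra rn1 => /eqP rr.
  have /eqP : (r - 1) * (r + 1) = 0 by rewrite mulrDr mulrBl rr; ring.
  by rewrite mulf_eq0 subr_eq0 => /orP[//|]; rewrite gt_eqF// addr_gt0.
apply/eqP; suff : a `^ (r * r - 1) == 1.
  by rewrite powR_eq1 (lt_gtF a0) (negbTE rr1) !orbF.
by rewrite powRB ?(gt_eqF a0) ?implybT// -ha powRr1 ?ltW// divff// gt_eqF.
Qed.

(** With c, d = +1 or -1 the values of y i at l and l', the kernel contains
    c e_l + d e_l' - 2 e_(k i); its dual functional kills y i, that is
    1 + 1 = 2 ^ (p - 1), hence p = 2. *)
Lemma at_most_two i l l' : l != k i -> l' != k i -> l != l' ->
  ell_fun (y i) l != 0 -> ell_fun (y i) l' = 0.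
Proof.
move=> lk l'k ll' c0; apply/eqP; apply: contraT => d0.
have c1 := norm_coord1 c0; have d1 := norm_coord1 d0.
set c := ell_fun (y i) l in c0 c1 *; set d := ell_fun (y i) l' in d0 d1 *.
have cc : c * c = 1 by rewrite -expr2 -real_normK ?num_real// c1 expr1n.
have dd : d * d = 1 by rewrite -expr2 -real_normK ?num_real// d1 expr1n.
pose z : E := c *: zeta l + d *: zeta l'.
have zE : z = c *: delta l + d *: delta l' - 2 *: delta (k i).
  rewrite /z (zeta2 c0) (zeta2 d0) -/c -/d !spow_abs1//.
  by rewrite !scalerBr !scalerA cc dd addrACA -opprD -scalerDl.
have Pz : P z = 0 by rewrite linearD !linearZ/= !zeta_ker !scaler0 addr0.
have zq q : ell_fun z q = c * (q == l)%:R + d * (q == l')%:R - 2 * (q == k i)%:R.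
  by rewrite zE !ellE !ell_deltaE.
pose m := maxn (bnd l) (bnd l').
have := range_pairing_ker (Py i) Pz (m := m).
rewrite (@big_ord_supp R [:: l; l'; k i] _
  (fun q => spow r (z q) * ell_fun (y i) q)); first last.
- move=> q; rewrite !inE !negb_or => /and3P[ql ql' qk].
  by rewrite zq (negbTE ql) (negbTE ql') (negbTE qk) !mulr0 addr0 subr0 spow0 mul0r.
- by move=> q; rewrite !inE /m => /or3P[]/eqP->; rewrite leq_max ?l_bnd ?ki_bnd ?orbT.
- by rewrite /= !inE negb_or ll' lk l'k.
rewrite !big_cons big_nil !zq !eqxx ![k i == _]eq_sym (negbTE lk) (negbTE l'k).
rewrite [l' == l]eq_sym (negbTE ll') !mulr0 !mulr1 !addr0 !subr0 !add0r.
have -> : ell_fun (y i) l = c by [].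
have -> : ell_fun (y i) l' = d by [].
rewrite yk eqxx (spow_abs1 r c1) (spow_abs1 r d1) cc dd spowN gt0_spow// mulr1 => H.
have tl0 : forall q, (m <= q)%N -> ell_fun (y i) q * z q = 0.
  move=> q; rewrite geq_max => /andP[ql ql'].
  by rewrite /z ellD !ellZ !zeta_supp// !mulr0 addr0 mulr0.
have /eqP := H tl0.
by rewrite addrA subr_eq0 eq_sym (negbTE two_r).
Qed.

(** When y i is a single coordinate vector its e i is 0 and l i is an arbitrary
    index outside the range of k, which keeps the two cases uniform below. *)
Lemma basis_shape : exists (l : 'I_n -> nat) (e : 'I_n -> R),
  [/\ forall i, e i = 0 \/ `|e i| = 1,
      forall i j, l i != k j &
      forall i q, ell_fun (y i) q = (q == k i)%:R + e i * (q == l i)%:R].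
Proof.
have H i : exists le : nat * R, [/\ le.2 = 0 \/ `|le.2| = 1,
    forall j, le.1 != k j &
    forall q, ell_fun (y i) q = (q == k i)%:R + le.2 * (q == le.1)%:R].
  have [[l lk c0]|no] := pselect (exists2 l, l != k i & ell_fun (y i) l != 0).
    exists (l, ell_fun (y i) l) => /=; split => [|j|q].
    - by right; exact: norm_coord1.
    - apply/eqP => lkj; have := c0; rewrite lkj yk.
      case: (eqVneq i j) => [ij|]; last by rewrite eqxx.
      by move: lk; rewrite lkj ij eqxx.
    - have [->|qk] := eqVneq q (k i).
        by rewrite yk eqxx eq_sym (negbTE lk) mulr0 addr0.
      have [->|ql] := eqVneq q l; first by rewrite add0r mulr1.
      by rewrite (at_most_two lk qk _ c0) 1?eq_sym// add0r mulr0.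
  exists ((\sum_j k j).+1, 0); split => [|j|q]; first by left.
  - by rewrite gtn_eqF// ltnS (bigD1 j)//= leq_addr.
  - rewrite mul0r addr0; have [->|qk] := eqVneq q (k i); first by rewrite yk eqxx.
    by apply/eqP; apply: contraT => c0; exfalso; apply: no; exists q.
have [f fP] := choice H.
by exists (fun i => (f i).1), (fun i => (f i).2); split => i; have [] := fP i.
Qed.

(** Necessity is orthogonality to y i. Conversely P z inherits the equations from
    z, as z - P z satisfies them, and on the span of the y i they read
    a_i (1 + e_i ^ 2) = 0. *)
Lemma kerP (l : 'I_n -> nat) (e : 'I_n -> R) :
  (forall i, e i = 0 \/ `|e i| = 1) -> (forall i j, l i != k j) ->
  (forall i q, ell_fun (y i) q = (q == k i)%:R + e i * (q == l i)%:R) ->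
  forall z : E, P z = 0 <-> forall i, ell_fun z (k i) + e i * z (l i) = 0.
Proof.
move=> e1 lk yE.
have nec z : P z = 0 -> forall i, ell_fun z (k i) + e i * z (l i) = 0.
  move=> Pz i.
  have se : spow r (e i) = e i.
    by have [->|/spow_abs1->] := e1 i; rewrite ?spow0.
  have kl : (k i == l i) = false by rewrite eq_sym; exact/negbTE.
  have lki : (l i == k i) = false by exact/negbTE.
  have := ker_pairing_range (Py i) Pz (m := (maxn (k i) (l i)).+1).
  rewrite (@big_ord_supp R [:: k i; l i] _
    (fun q => spow r (ell_fun (y i) q) * z q)); first last.
  - move=> q; rewrite !inE !negb_or => /andP[qk ql].
    by rewrite yE (negbTE qk) (negbTE ql) mulr0 addr0 spow0 mul0r.
  - by move=> q; rewrite !inE ltnS leq_max => /orP[]/eqP->; rewrite leqnn ?orbT.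
  - by rewrite /= inE kl.
  rewrite big_cons big_seq1 !yE !eqxx kl lki mulr0 mulr1 add0r addr0 spow1 mul1r se.
  apply=> q; rewrite gtn_max => /andP[kq lq].
  by rewrite yE !gtn_eqF// mulr0 addr0 mul0r.
move=> z; split; first exact: nec.
move=> zP.
have a0 i : ell_fun (P z) (k i) = 0.
  have := nec (z - P z); rewrite linearB/= P_idem subrr => /(_ erefl i).
  rewrite !ellE => h.
  have {}h : ell_fun (P z) (k i) + e i * ell_fun (P z) (l i) = 0.
    by have := zP i; move: h; lra.
  move: h; set a := ell_fun (P z) (k i) => h.
  have [ei0|ei1] := e1 i; first by rewrite ei0 mul0r addr0 in h.
  have ee : e i * e i = 1 by rewrite -expr2 -real_normK ?num_real// ei1 expr1n.
  have yil : ell_fun (y i) (l i) = e i.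
    by rewrite yE (negbTE (lk i i)) eqxx add0r mulr1.
  have : ell_fun (P z) (l i) = a * e i.
    rewrite P_coord ell_sum (bigD1 i)//= big1 => [|j ji].
      by rewrite addr0 ellZ yil.
    rewrite ellZ (@disjoint_supports i j) ?mulr0 1?eq_sym// yil.
    by apply/eqP => ei0; move: ei1; rewrite -ei0 normr0 => /eqP; rewrite eq_sym oner_eq0.
  move=> hl; move: h; rewrite hl mulrCA ee mulr1 => h.
  by lra.
by rewrite P_coord big1// => i _; rewrite a0 scale0r.
Qed.

End bicontractive.

(** * A basis dual to coordinate functionals *)

Section coordinate_basis.
Context {R : realType} {p : R} (p1 : 1 < p).
Local Notation E := (ell (ltW p1)).

(** Among the truncations of the n x infinity matrix of the e i to m columns, one
    has maximal rank. If that rank were below n, a vector of its left kernel would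
    annihilate all the columns, a relation between the e i. So some n columns form
    an invertible matrix, whose inverse gives the change of basis. *)
Lemma coordinate_basis n (e : 'I_n -> E) :
  (forall a : 'I_n -> R, \sum_i a i *: e i = 0 -> forall i, a i = 0) ->
  exists (y : 'I_n -> E) (k : 'I_n -> nat),
    (forall i j, ell_fun (y i) (k j) = (i == j)%:R) /\
    [set \sum_i a i *: e i | a in [set: 'I_n -> R]] =
    [set \sum_i a i *: y i | a in [set: 'I_n -> R]].
Proof.
move=> efree.
pose M m := \matrix_(i < n, q < m) ell_fun (e i) q.
have [m Mn] : exists m, \rank (M m) = n.
  have ex : exists d, `[< exists m, \rank (M m) = d >].
    by exists (\rank (M 0%N)); apply/asboolP; exists 0%N.
  have ub d : `[< exists m, \rank (M m) = d >] -> (d <= n)%N.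
    by move=> /asboolP[m <-]; exact: rank_leq_row.
  have [_ /asboolP[m <-] mmax] := ex_maxnP ex ub.
  exists m; apply/eqP; rewrite eqn_leq rank_leq_row/= leqNgt.
  apply/negP => Mn.
  have : kermx (M m) != 0 by rewrite -mxrank_eq0 mxrank_ker -lt0n subn_gt0.
  move=> /rowV0Pn[u uM u0].
  have ue q : \sum_i u 0 i * ell_fun (e i) q = 0.
    pose mx := maxn m q.+1.
    have mle : (m <= mx)%N by rewrite leq_maxl.
    have qm' : (q < mx)%N by rewrite leq_maxr.
    have sub : (kermx (M mx) <= kermx (M m))%MS.
      apply/sub_kermxP/matrixP => i j; rewrite !mxE.
      have := congr1 (fun A : 'M[R]_(n, mx) => A i (widen_ord mle j))
        (mulmx_ker (M mx)).
      rewrite !mxE => h; rewrite -[RHS]h.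
      by apply: eq_bigr => s _; rewrite !mxE.
    have : (kermx (M m) <= kermx (M mx))%MS.
      rewrite -(mxrank_leqif_sup sub) !mxrank_ker.
      rewrite eqn_leq; apply/andP; split; last first.
        by apply: leq_sub2l; apply: mmax; apply/asboolP; exists mx.
      by have := mxrankS sub; rewrite !mxrank_ker.
    move=> /(submx_trans uM)/sub_kermxP.
    move=> /(congr1 (fun A : 'M[R]_(1, mx) => A 0 (Ordinal qm'))).
    rewrite !mxE => h; rewrite -[RHS]h.
    by apply: eq_bigr => i _; rewrite !mxE.
  have := efree (u 0) _; case/eqP : u0; apply/rowP => i; rewrite mxE.
  apply: efree; apply: ell_ext => q; rewrite ell_sum ell0 -[RHS](ue q).
  by apply: eq_bigr => s _; rewrite ellZ.
have full : row_full (M m)^T by rewrite /row_full mxrank_tr Mn.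
pose f := fullrankfun full.
pose B : 'M[R]_n := \matrix_(i, j) ell_fun (e i) (f j).
have uB : B \in unitmx.
  rewrite -unitmx_tr; have := fullrowsub_unit full; congr (_ \in unitmx).
  by apply/matrixP => i j; rewrite !mxE.
pose C := invmx B.
pose y i := \sum_s C i s *: e s.
exists y, (fun j => f j : nat); split=> [i j|].
  rewrite /y ell_sum.
  have := congr1 (fun A : 'M[R]_n => A i j) (mulVmx uB).
  rewrite !mxE => h; rewrite -[RHS]h.
  by apply: eq_bigr => s _; rewrite ellZ mxE.
have ye s : e s = \sum_i B s i *: y i.
  rewrite /y; under eq_bigr do rewrite scaler_sumr.
  rewrite exchange_big/= (bigD1 s)//= [X in _ + X]big1 => [|t ts].
    rewrite addr0; under eq_bigr do rewrite scalerA.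
    rewrite -scaler_suml.
    have := congr1 (fun A : 'M[R]_n => A s s) (mulmxV uB); rewrite !mxE eqxx => ->.
    by rewrite scale1r.
  under eq_bigr do rewrite scalerA.
  rewrite -scaler_suml.
  have := congr1 (fun A : 'M[R]_n => A s t) (mulmxV uB).
  rewrite !mxE eq_sym (negbTE ts) => ->.
  by rewrite scale0r.
apply/seteqP; split=> _ [a _ <-].
  exists (fun i => \sum_s a s * B s i) => //.
  under eq_bigr do rewrite scaler_suml.
  rewrite exchange_big/=; apply: eq_bigr => s _; rewrite [in RHS]ye scaler_sumr.
  by apply: eq_bigr => i _; rewrite scalerA.
exists (fun s => \sum_i a i * C i s) => //.
under eq_bigr do rewrite scaler_suml.
rewrite exchange_big/=; apply: eq_bigr => i _; rewrite /y scaler_sumr.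
by apply: eq_bigr => s _; rewrite scalerA.
Qed.

End coordinate_basis.

(** * The norm as a supremum over functionals *)

Section norming.
Context {R : realType} {p : R} (p1 : 1 < p).
Local Notation E := (ell (ltW p1)).

Let p0 : 0 < p. Proof. exact: lt_trans p1. Qed.

Lemma ell_normp_le (x : E) C :
  (forall m, \sum_(q < m) `|x q| `^ p <= C) -> `|x| `^ p <= C.
Proof.
move=> xC; rewrite -lee_fin ell_normpE; apply: lime_le.
  by apply: is_cvg_nneseries => q _ _; rewrite lee_fin powR_ge0.
by apply: nearW => m; rewrite /= big_mkord sumEFin lee_fin.
Qed.

Lemma normp_partial_le (x : E) m : \sum_(q < m) `|x q| `^ p <= `|x| `^ p.
Proof. by have [T T0 ->] := ell_split x m; rewrite lerDl. Qed.

(** A substitute for the Hahn-Banach theorem: the functional dual to the truncation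
    of y to m coordinates has norm at most 1 by Hoelder's inequality and takes at y
    the value of the norm of that truncation. *)
Lemma norm_by_duality (y : E) C : 0 <= C ->
  (forall f : dual E, `|f y| <= `|f| * C) -> `|y| <= C.
Proof.
move=> C0 fy.
apply: (powR_le_inv p0) => //.
apply: ell_normp_le => m; set s := (X in X <= _).
have s0 : 0 <= s by apply: sumr_ge0 => q _; exact: powR_ge0.
have [->|sn0] := eqVneq s 0; first exact: powR_ge0.
have sp : 0 < s by rewrite lt_neqAle eq_sym sn0.
pose c := s `^ p^-1.
have c0 : 0 < c by rewrite powR_gt0.
have cp : c `^ p = s by rewrite -powRrM mulVf ?gt_eqF// powRr1.
have u1 : \sum_(q < m) `|y q / c| `^ p = 1 by exact: sum_powR_normalised.
pose g (z : E) := \sum_(q < m) spow (p - 1) (y q / c) * z q.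
have lg : linear (g : E -> R^o).
  move=> a u v; rewrite /g scaler_sumr -big_split/=.
  apply: eq_bigr => q _; rewrite ellD ellZ mulrDr; congr (_ + _).
  by rewrite /GRing.scale/= mulrCA.
have gle z : g z <= `|z|.
  have [->|z0] := eqVneq z 0.
    by rewrite /g big1 ?normr0// => q _; rewrite ell0 mulr0.
  have nz : 0 < `|z| by rewrite normr_gt0.
  rewrite -[leRHS]mul1r -ler_pdivrMr// /g mulr_suml.
  under eq_bigr do rewrite -mulrA.
  apply: young_sum => //; first by rewrite u1.
  under eq_bigr do rewrite normrM powRM// normfV normr_id.
  rewrite -mulr_suml -(powR_inv1 (ltW nz)) -powRrM mulN1r powRN.
  by rewrite ler_pdivrMr ?powR_gt0// mul1r; exact: normp_partial_le.
have gb z : `|g z| <= 1 * `|z|.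
  rewrite mul1r ler_norml gle andbT lerNl.
  have -> : - g z = g (- z).
    by rewrite /g -sumrN; apply: eq_bigr => q _; rewrite ellN mulrN.
  by rewrite -(normrN z).
have [d dE] := bounded_dual lg gb.
have d1 : `|d| <= 1 by apply: dual_norm_le => // z; rewrite dE.
have gy : g y = c.
  rewrite -[RHS]mul1r -u1 mulr_suml; apply: eq_bigr => q _.
  rewrite -[X in `|_| `^ X](subrK 1) -spow_mulr ?subr_gt0//.
  by rewrite -[RHS]mulrA divfK// gt_eqF.
have cC : c <= C.
  rewrite -gy -dE (le_trans (ler_norm _))// (le_trans (fy d))//.
  by rewrite ler_piMl.
by rewrite -cp; apply: ge0_ler_powR; rewrite ?nnegrE// ?ltW.
Qed.

End norming.

(** * Isometries with l_p and l_p(n) *)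

Section coupled.
Context {R : realType} {p : R} (p1 : 1 < p).
Local Notation E := (ell (ltW p1)).

Let p0 : 0 < p. Proof. exact: lt_trans p1. Qed.

Lemma cofinite_enum n (k : 'I_n -> nat) : exists phi psi : nat -> nat,
  [/\ forall m i, phi m != k i, cancel phi psi &
      forall q, (forall i, q != k i) -> phi (psi q) = q].
Proof.
have : infinite_set (~` range k).
  apply: cofinite_set_infinite; first exact: infinite_nat.
  rewrite setCK; apply: finite_image; exact: finite_finset.
have cD : countable (~` range k) by exact: countableP.
move=> /(eq_card_nat cD)/card_esym/ppcard_eqP[f].
have [fA finj fsurj] : set_bij setT (~` range k) f by exact: bij.
have H q : exists m, (forall i, q != k i) -> f m = q.
  have [qA|qA] := pselect (forall i, q != k i); last by exists 0%N.
  have [|m _ <-] := fsurj q; last by exists m.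
  by move=> [i _ e]; have := qA i; rewrite e eqxx.
have [psi psiP] := choice H.
exists f, psi.
have fk m i : f m != k i.
  by apply/eqP => e; have := fA m I; apply; exists i.
split=> // m; apply: finj; rewrite ?inE//.
by apply: psiP => i.
Qed.

Lemma esum_delta (a : nat) (c : \bar R) : (0 <= c)%E ->
  (\esum_(q in [set: nat]) (if q == a then c else 0) = c)%E.
Proof.
move=> c0; rewrite -[RHS](@esum_set1 _ _ a (fun _ => c))// [RHS]esum_mkcond.
apply: eq_esum => q _; congr (if _ then _ else _).
by apply/eqP/idP => [->|]; rewrite inE.
Qed.

(** The subspace is parametrised by its coordinates outside the range of k. The
    coordinate q then occurs once by itself and, multiplied by e i, once for each i
    with l i = q; the weight w q makes these contributions to the p-th power of the
    norm add up to that of one coordinate. *)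
Lemma coupled_isometry n (k l : 'I_n -> nat) (e : 'I_n -> R) : injective k ->
  (forall i j, l i != k j) ->
  isometrically_isomorphic
    [set z : E | forall i, z (k i) + e i * z (l i) = 0] E.
Proof.
move=> kinj lk; have [phi [psi [phik phiK psiK]]] := cofinite_enum k.
pose w q : R := (1 + \sum_i (if q == l i then `|e i| `^ p else 0)) `^ - p^-1.
have W0 q : 0 < 1 + \sum_i (if q == l i then `|e i| `^ p else 0).
  rewrite ltr_pwDl// sumr_ge0// => i _; case: ifP => // _; exact: powR_ge0.
have w0 q : 0 < w q by exact: powR_gt0.
have wp q : w q `^ p * (1 + \sum_i (if q == l i then `|e i| `^ p else 0)) = 1.
  rewrite /w -powRrM mulNr mulVf ?gt_eqF// powRN powRr1 ?ltW// mulVf//.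
  by rewrite gt_eqF.
pose Tf (x : nat -> R) q := if [pick i | k i == q] is Some i
  then - e i * (w (l i) * x (psi (l i))) else w q * x (psi q).
have Tfk x i : Tf x (k i) = - e i * (w (l i) * x (psi (l i))).
  rewrite /Tf; case: pickP => [j /eqP/kinj->//|/(_ i)]; by rewrite eqxx.
have Tff x q : (forall i, q != k i) -> Tf x q = w q * x (psi q).
  move=> qk; rewrite /Tf; case: pickP => // j /eqP kq.
  by have := qk j; rewrite kq eqxx.
have Tfl x i : Tf x (l i) = w (l i) * x (psi (l i)) by exact: Tff.
(* stated for arbitrary sequences, so that it also shows that a preimage under
   Tf of an element of l_p is in l_p *)
have normT x :
    (\sum_(q <oo) (`|Tf x q| `^ p)%:E = \sum_(q <oo) (`|x q| `^ p)%:E)%E.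
  rewrite !nneseries_esumT; do ?by move=> q; rewrite lee_fin powR_ge0.
  pose F q : R := `|w q * x (psi q)| `^ p.
  have F0 q : 0 <= F q by exact: powR_ge0.
  pose A := [set q | forall i, q != k i].
  pose cc i := (`|e i| `^ p * F (l i))%:E.
  have cc0 i : (0 <= cc i)%E by rewrite lee_fin mulr_ge0// powR_ge0.
  have ite0 (b : bool) (c : \bar R) : (0 <= c)%E -> (0 <= if b then c else 0)%E.
    by case: b.
  transitivity (\esum_(q in [set: nat]) ((if q \in A then (F q)%:E else 0) +
      \sum_i (if q == k i then cc i else 0)))%E.
    apply: eq_esum => q _.
    have [qA|/existsNP[i /negP/negPn/eqP qki]] := pselect (A q).
      rewrite mem_set// Tff// big1 ?adde0// => i _.
      by rewrite (negbTE (qA i)).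
    rewrite memNset; last by move=> /(_ i); rewrite qki eqxx.
    rewrite qki Tfk (bigD1 i)//= eqxx big1 => [|j ji]; last first.
      by rewrite (inj_eq kinj) eq_sym (negbTE ji).
    rewrite add0e adde0 /cc /F normrM powRM// normrN//.
  (* the mass that q = k i carries is moved to q = l i *)
  transitivity (\esum_(q in [set: nat]) ((if q \in A then (F q)%:E else 0) +
      \sum_i (if q == l i then cc i else 0)))%E.
    rewrite !esumD; do ?[by move=> q _; apply: ite0; rewrite lee_fin |
       by move=> q _; apply: sume_ge0 => i _; exact: ite0].
    congr (_ + _)%E; rewrite !esum_sum; do ?by move=> q i _ _; exact: ite0.
    by apply: eq_bigr => i _; rewrite !esum_delta.
  transitivity (\esum_(q in A) (`|x (psi q)| `^ p)%:E)%E.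
    rewrite [RHS]esum_mkcond; apply: eq_esum => q _.
    case: ifPn => [/set_mem qA|/negP qA]; last first.
      rewrite add0e big1// => i _; case: ifPn => // /eqP qli; exfalso; apply: qA.
      by apply/mem_set => j; rewrite qli.
    rewrite -[in RHS](mul1r (_ `^ p)) -(wp q) -mulrA mulrC -mulrA.
    rewrite [X in (_ * X)%:E]mulrC -powRM ?(ltW (w0 q))//.
    rewrite -[w q in RHS]gtr0_norm// -normrM -/(F q) mulrDl mul1r EFinD mulr_suml.
    congr (_ + _)%E; rewrite -sumEFin; apply: eq_bigr => i _.
    by case: ifPn => [/eqP->|_]; rewrite ?mul0r.
  have bij : set_bij [set: nat] A phi.
    split.
    - by move=> m _ i; exact: phik.
    - by move=> a b _ _; exact: (can_inj phiK).
    - by move=> q qA; exists (psi q) => //; exact: psiK.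
  rewrite (reindex_esum _ _ _ _ bij); apply: eq_esum => m _.
  by rewrite phiK.
have fin (z : E) : (\sum_(q <oo) (`|z q| `^ p)%:E < +oo)%E.
  by rewrite -ell_normpE ltry.
have HT (x : E) : exists z : E, forall q, z q = Tf x q.
  by apply: ell_mk; rewrite normT.
have [T TE] := choice HT.
have lT : linear T.
  move=> a u v; apply: ell_ext => q; rewrite ellD ellZ !TE /Tf.
  by case: pickP => [i _|_]; rewrite ellD ellZ; ring.
pose TL : {linear E -> E} := HB.pack T (GRing.isLinear.Build R E E _ T lT).
exists TL; split.
  move=> x; apply: ell_norm_powP; apply: EFin_inj; rewrite !ell_normpE -[RHS]normT.
  by apply: eq_eseriesr => q _; rewrite TE.
apply/seteqP; split.
  move=> _ [x _ <-] i /=; rewrite !TE Tfk Tfl; ring.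
move=> z zP.
have zT q : Tf (fun m => z (phi m) / w (phi m)) q = z q.
  have [qA|/existsNP[i /negP/negPn/eqP qki]] := pselect (forall i, q != k i).
    by rewrite Tff// psiK// mulrCA divff ?mulr1// gt_eqF.
  rewrite qki Tfk psiK => [|j]; last exact: lk.
  rewrite [w _ * _]mulrC divfK ?gt_eqF//.
  by apply/eqP; rewrite mulNr eq_sym -addr_eq0; apply/eqP; exact: zP.
have [x xE] : exists x : E, forall m, x m = z (phi m) / w (phi m).
  apply: ell_mk; rewrite -normT.
  by under eq_eseriesr do rewrite zT; exact: fin.
exists x => //; apply: ell_ext => q; rewrite TE -[RHS]zT; congr (Tf _ q).
exact/funext.
Qed.

End coupled.

Section disjoint_span.
Context {R : realType} {p : R} (p1 : 1 < p).
Local Notation E := (ell (ltW p1)).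

Let p0 : 0 < p. Proof. exact: lt_trans p1. Qed.

Lemma disjoint_span_isometry n (y : 'I_n -> E) :
  (forall i, y i != 0) ->
  (forall i j k, i != j -> ell_fun (y i) k * ell_fun (y j) k = 0) ->
  isometrically_isomorphic [set \sum_i a i *: y i | a in [set: 'I_n -> R]]
    (ell_fin (ltW p1) n).
Proof.
move=> y0 yy.
have n0 i : 0 < `|y i| by rewrite normr_gt0.
pose T (x : ell_fin (ltW p1) n) : E := \sum_i ((x : 'rV[R]_n) 0 i / `|y i|) *: y i.
have lT : linear T.
  move=> a u v; rewrite /T scaler_sumr -big_split/=; apply: eq_bigr => i _.
  by rewrite scalerA -scalerDl !mxE; congr (_ *: _); ring.
pose TL : {linear ell_fin (ltW p1) n -> E} :=
  HB.pack T (GRing.isLinear.Build R (ell_fin (ltW p1) n) E _ T lT).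
exists TL; split.
  move=> x; have : `|T x| `^ p = \sum_(i < n) `|(x : 'rV[R]_n) 0 i| `^ p.
    rewrite normp_disjoint_sum//; apply: eq_bigr => i _.
    rewrite -powRM//; congr (_ `^ _).
    by rewrite normrM normfV normr_id divfK// gt_eqF.
  move=> h; rewrite ell_fin_normE -h -powRrM mulfV ?gt_eqF// powRr1//.
apply/seteqP; split.
  by move=> _ [x _ <-]; exists (fun i => (x : 'rV[R]_n) 0 i / `|y i|).
move=> _ [a _ <-]; exists (\row_i (a i * `|y i|)) => //=.
by apply: eq_bigr => i _; rewrite mxE mulfK// gt_eqF.
Qed.

End disjoint_span.

(** * Property (HB) and bi-contractive projections *)

Section combination_basis.
Context {R : realType} {V : lmodType R}.

Lemma span_basis n (y : 'I_n -> V) i :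
  [set \sum_j a j *: y j | a in [set: 'I_n -> R]] (y i).
Proof.
exists (fun j => (j == i)%:R) => //.
rewrite (bigD1 i)//= eqxx scale1r big1 ?addr0// => j /negbTE->.
by rewrite scale0r.
Qed.

End combination_basis.

Section main.
Context {R : realType} {p : R} (p1 : 1 < p) (pn2 : p != 2).
Local Notation E := (ell (ltW p1)).
Implicit Types (Y : set E) (x z v : E).

Let p0 : 0 < p. Proof. exact: lt_trans p1. Qed.

Lemma bicontractive_structure n Y (P : {linear E -> E}) :
  has_dim Y n -> projection_onto P Y ->
  (forall x, `|P x| <= `|x|) -> (forall x, `|x - P x| <= `|x|) ->
  [/\ isometrically_isomorphic Y (ell_fin (ltW p1) n),
      isometrically_isomorphic (range (fun x => x - P x)) E &
      exists m, forall v q, Y v -> (m <= q)%N -> v q = 0].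
Proof.
move=> [b [bfree YE]] [Pidem PY] P1 Q1.
have [y [k [yk]]] := coordinate_basis bfree; rewrite -YE => {b bfree} {}YE.
have Py i : P (y i) = y i.
  have : Y (y i) by rewrite YE; exact: span_basis.
  by rewrite -PY => -[x _ <-].
have Pspan x : exists a : 'I_n -> R, P x = \sum_i a i *: y i :> E.
  have : Y (P x) by rewrite -PY; exists x.
  by rewrite YE => -[a _ <-]; exists a.
have [l [e [e1 lk yE]]] := basis_shape pn2 yk Py Pspan P1 Q1.
have kerE := kerP pn2 yk Py Pspan P1 e1 lk yE.
split.
- rewrite YE; apply: disjoint_span_isometry.
    move=> i; apply/eqP => y0; have := yk i i; rewrite y0 ell0 eqxx => /eqP.
    by rewrite eq_sym oner_eq0.
  move=> i j q ij; have [->|c0] := eqVneq (ell_fun (y i) q) 0.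
    by rewrite mul0r.
  by rewrite (disjoint_supports pn2 yk Py Pspan P1 ij c0) mulr0.
- have -> : range (fun x => x - P x) =
      [set z : E | forall i, z (k i) + e i * z (l i) = 0].
    apply/seteqP; split=> [_ [x _ <-]|z zP].
      by apply/kerE; rewrite linearB/= Pidem subrr.
    by exists z => //; have /kerE -> := zP; rewrite subr0.
  apply: coupled_isometry => // i j kij.
  apply/eqP; have := yk i j; rewrite -kij yk eqxx => /esym/eqP.
  by case: (i == j) => //; rewrite eq_sym oner_eq0.
- exists (\sum_i (k i + l i)).+1 => v q; rewrite YE => -[a _ <-] q0.
  rewrite ell_sum big1// => i _; rewrite ellZ yE.
  move: q0; rewrite (bigD1 i)//= => q0.
  rewrite !gtn_eqF ?mulr0 ?addr0 ?mulr0//.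
    by apply: leq_trans q0; rewrite ltnS -addnA addnCA leq_addr.
  by apply: leq_trans q0; rewrite ltnS -addnA leq_addr.
Qed.

(** The G-components g i of the coordinate functionals at the k i are dual to the
    basis y, so P = sum of g i (x) y i projects onto Y, and composition with P sends
    every functional to its G-component. The two norm estimates of property (HB)
    say that composition with P and with I - P is contractive on the dual, and by
    duality so are P and I - P. *)
Lemma HB_projection n Y : has_dim Y n -> property_HB Y ->
  exists P : {linear E -> E}, [/\ projection_onto P Y,
    forall x, `|P x| <= `|x| & forall x, `|x - P x| <= `|x|].
Proof.
move=> [b [bfree YE]] [G [Gsub _ [_ Gdec] GHB]].
have [y [k [yk]]] := coordinate_basis bfree; rewrite -YE => {b bfree} {}YE.
have Yy i : Y (y i) by rewrite YE; exact: span_basis.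
have H i : exists g : dual E, G g /\ forall j, g (y j) = (i == j)%:R.
  have [|x|d dE] := @bounded_dual R E (fun x => x (k i)) 1.
  - by move=> a u v; rewrite ellD ellZ.
  - by rewrite mul1r; exact: ell_coord_le.
  have [g [h [Gg Yh dgh]]] := Gdec d.
  exists g; split=> // j.
  have : d (y j) = g (y j) + h (y j) by rewrite dgh.
  by rewrite (Yh _ (Yy j)) addr0 dE yk eq_sym => <-.
have [g gP] := choice H.
pose Pf x : E := \sum_i g i x *: y i.
have lP : linear Pf.
  move=> a u v; rewrite /Pf scaler_sumr -big_split/=; apply: eq_bigr => i _.
  by rewrite linearP scalerDl scalerA.
have [P PE] : exists P : {linear E -> E}, forall x, P x = \sum_i g i x *: y i.
  pose P : {linear E -> E} := HB.pack Pf (GRing.isLinear.Build R E E _ Pf lP).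
  by exists P.
have Py i : P (y i) = y i.
  rewrite PE (bigD1 i)//= (gP i).2 eqxx scale1r big1 ?addr0// => j ji.
  by rewrite (gP j).2 (negbTE ji) scale0r.
have YP x : Y (P x) by rewrite YE; exists (fun i => g i x).
have Pid v : Y v -> P v = v.
  rewrite YE => -[a _ <-]; rewrite linear_sum/=; apply: eq_bigr => i _.
  by rewrite linearZ/= Py.
have contr (f : dual E) : exists u w : dual E,
    [/\ forall x, u x = f (P x), forall x, w x = f (x - P x),
     `|u| <= `|f| & `|w| <= `|f|].
  pose u : dual E := \sum_i f (y i) *: g i.
  have uE x : u x = f (P x).
    rewrite PE linear_sum/= /u.
    have -> : (\sum_i f (y i) *: g i : dual E) x = \sum_i (f (y i) *: g i : dual E) x.
      by elim/big_ind2 : _ => // a1 x1 a2 x2 <- <-.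
    by apply: eq_bigr => i _; rewrite linearZ/=; exact: mulrC.
  have wE x : (f - u) x = f (x - P x) by rewrite linearB/= -uE.
  have Gu : G u.
    have [G0 GZ] := Gsub.
    rewrite /u; elim/big_ind : _ => [|a c Ga Gc|i _].
    - by have := G0; rewrite inE.
    - have := GZ 1 a c; rewrite !inE scale1r; exact.
    - have := GZ (f (y i)) (g i) 0; rewrite !inE addr0; apply; first exact: (gP i).1.
      by have := G0; rewrite inE.
  have Yw : annihilator Y (f - u).
    by move=> v Yv; rewrite wE (Pid v Yv) subrr linear0.
  have fuw : f = u + (f - u) by rewrite addrC subrK.
  exists u, (f - u); have [w0|/eqP w0] := eqVneq (f - u) 0.
    split=> //; last by rewrite w0 normr0.
    by rewrite [in leRHS]fuw w0 addr0.
  by have [/ltW ? ?] := GHB f u (f - u) Gu Yw w0 fuw.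
exists P; split.
- split=> [x|]; first exact: Pid.
  by apply/seteqP; split=> [_ [x _ <-]//|v Yv]; exists v => //; exact: Pid.
- move=> x; apply: norm_by_duality => // f.
  have [u [w [uE wE uf wf]]] := contr f.
  by rewrite -uE (le_trans (dual_bound u x))// ler_wpM2r.
- move=> x; apply: norm_by_duality => // f.
  have [u [w [uE wE uf wf]]] := contr f.
  by rewrite -wE (le_trans (dual_bound w x))// ler_wpM2r.
Qed.

(** Write the coefficients of f o T as spow (p - 1) (u i), and let c be the norm of
    u; the vector u / c realises equality in Hoelder's inequality. *)
Lemma functional_attains_max n (T : {linear ell_fin (ltW p1) n -> E}) (f : dual E) :
  exists x0 : ell_fin (ltW p1) n, `|x0| <= 1 /\
    forall x : ell_fin (ltW p1) n, `|x| <= 1 -> f (T x) <= f (T x0).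
Proof.
pose r := p - 1.
have r0 : 0 < r by rewrite subr_gt0.
pose d (i : 'I_n) : ell_fin (ltW p1) n := delta_mx 0 i.
pose b i := f (T (d i)).
have fT (x : ell_fin (ltW p1) n) : f (T x) = \sum_i b i * (x : 'rV[R]_n) 0 i.
  have {1}-> : x = \sum_i (x : 'rV[R]_n) 0 i *: d i.
    exact: row_sum_delta.
  rewrite !linear_sum/=; apply: eq_bigr => i _.
  by rewrite !linearZ/= mulrC.
have norm1 (x : ell_fin (ltW p1) n) :
    (`|x| <= 1) = (\sum_i `|(x : 'rV[R]_n) 0 i| `^ p <= 1).
  rewrite ell_fin_normE; set s := \sum_i _.
  have s0 : 0 <= s by apply: sumr_ge0 => i _; exact: powR_ge0.
  have le1 (a t : R) : 0 <= t -> 0 <= a -> a <= 1 -> a `^ t <= 1.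
    move=> t0 a0 a1; have <- : 1 `^ t = 1 :> R by rewrite powR1.
    by apply: ge0_ler_powR; rewrite ?nnegrE.
  apply/idP/idP => [h|]; last by apply: le1; rewrite ?invr_ge0 ?(ltW p0).
  have -> : s = (s `^ p^-1) `^ p by rewrite -powRrM mulVf ?gt_eqF// powRr1.
  by apply: le1 h; rewrite ?powR_ge0 ?(ltW p0).
pose u i := spow r^-1 (b i).
have ub i : spow r (u i) = b i.
  by rewrite /u spow_spow mulVf ?gt_eqF// spow_exp1.
pose s := \sum_i `|u i| `^ p.
have s0 : 0 <= s by apply: sumr_ge0 => i _; exact: powR_ge0.
have [sz|sn0] := eqVneq s 0.
  exists 0; rewrite normr0; split=> // x _.
  rewrite !fT !big1// => i _; first by rewrite mxE mulr0.
  have /psumr_eq0P-/(_ (fun i _ => powR_ge0 _ _) i isT)/eqP := sz.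
  rewrite powR_eq0 normr_eq0 => /andP[/eqP ui _].
  by rewrite -ub ui spow0 mul0r.
have sp : 0 < s by rewrite lt_neqAle eq_sym sn0.
pose c := s `^ p^-1.
have c0 : 0 < c by rewrite powR_gt0.
have u1 : \sum_i `|u i / c| `^ p = 1 by exact: sum_powR_normalised.
pose x0 : ell_fin (ltW p1) n := \row_i (u i / c).
have fc (x : ell_fin (ltW p1) n) :
    f (T x) = spow r c * \sum_i spow r (u i / c) * (x : 'rV[R]_n) 0 i.
  rewrite fT mulr_sumr; apply: eq_bigr => i _.
  by rewrite [RHS]mulrA -spowM [c * _]mulrC divfK ?gt_eqF// ub.
have sc0 : 0 <= spow r c by rewrite gt0_spow// powR_ge0.
exists x0; split.
  by rewrite norm1; under eq_bigr do rewrite mxE; rewrite u1.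
move=> x; rewrite norm1 => x1; rewrite !fc ler_wpM2l//.
have -> : \sum_i spow r (u i / c) * (x0 : 'rV[R]_n) 0 i = 1.
  rewrite -[RHS]u1; apply: eq_bigr => i _.
  by rewrite mxE spow_mulr// subrK.
by apply: young_sum => //; rewrite u1.
Qed.

(** G consists of the functionals fixed by composition with P. Contractivity gives
    both inequalities in the weak form. If |g| = |f| > 0 for g = f o P, then f attains
    its norm on the unit sphere of Y, at v0 say; v0 is Birkhoff orthogonal to the
    kernel of P because P is contractive, so by smoothness f vanishes on that
    kernel and h = 0. Finite support of the elements of Y makes the
    differentiation elementary. *)
Lemma projection_HB n Y (P : {linear E -> E}) :
  projection_onto P Y ->
  (forall x, `|P x| <= `|x|) -> (forall x, `|x - P x| <= `|x|) ->
  isometrically_isomorphic Y (ell_fin (ltW p1) n) ->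
  (exists m, forall v q, Y v -> (m <= q)%N -> v q = 0) ->
  property_HB Y.
Proof.
move=> [Pidem PY] P1 Q1 [T [Tiso TY]] [m Ym].
have YP x : Y (P x) by rewrite -PY; exists x.
have Pid v : Y v -> P v = v by rewrite -PY => -[x _ <-].
pose G : set (dual E) := [set f | forall x, f (P x) = f x].
have comp (f : dual E) : exists g : dual E, forall x, g x = f (P x).
  apply: (@bounded_dual R E (fun x => f (P x)) `|f|).
    by move=> a u v; rewrite !linearP.
  by move=> x; rewrite (le_trans (dual_bound f _))// ler_wpM2l.
exists G; split.
- split; first by rewrite inE => x.
  move=> a f g; rewrite !inE => Gf Gg x.
  have E1 z : (a *: f + g) z = a * f z + g z by [].
  by rewrite !E1 Gf Gg.
- move=> f clf x; apply/eqP; rewrite -subr_eq0 -normr_le0.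
  apply/ler_addgt0Pr => e e0; rewrite add0r.
  have nx : 0 < `|P x - x| + 1 by rewrite ltr_wpDl.
  have := clf (ball f (e / (`|P x - x| + 1))) _.
  case; first by apply: nbhsx_ballx; rewrite divr_gt0.
  move=> g [Gg]; rewrite -ball_normE/= => fg.
  have -> : f (P x) - f x = (f - g) (P x - x).
    have E1 z : (f - g) z = f z - g z by [].
    by rewrite E1 !linearB/= Gg subrr addr0.
  rewrite (le_trans (dual_bound _ _))//.
  have : `|f - g| * (`|P x - x| + 1) <= e by rewrite -ler_pdivlMr// ltW.
  by apply: le_trans; rewrite ler_wpM2l// lerDl.
- split.
    apply/seteqP; split=> [f [Gf Yf]|f ->] /=.
      apply/val_inj/funext => x /=.
      by rewrite -[LHS]/(f x) -Gf (Yf _ (YP x)).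
    by split => [x|y _].
  move=> f; have [g gE] := comp f; exists g, (f - g); split.
  + by move=> x; rewrite !gE Pidem.
  + move=> v Yv; have -> : (f - g) v = f v - g v by [].
    by rewrite gE Pid// subrr.
  + by rewrite addrC subrK.
- move=> f g h Gg Yh h0 fgh.
  have gE x : g x = f (P x).
    rewrite -Gg fgh; have -> : (g + h) (P x) = g (P x) + h (P x) by [].
    by rewrite (Yh _ (YP x)) addr0.
  have hE x : h x = f (x - P x).
    rewrite linearB/= -gE fgh; have -> : (g + h) x = g x + h x by [].
    by rewrite addrAC subrr add0r.
  have gf : `|g| <= `|f|.
    apply: dual_norm_le => // x; rewrite gE (le_trans (dual_bound f _))//.
    by rewrite ler_wpM2l.
  split; last first.
    apply: dual_norm_le => // x; rewrite hE (le_trans (dual_bound f _))//.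
    by rewrite ler_wpM2l.
  rewrite lt_neqAle gf andbT; apply/eqP => ng; apply: h0.
  have [x0 [x01 x0max]] := functional_attains_max T f.
  pose v0 := T x0.
  have v01 : `|v0| <= 1 by rewrite Tiso.
  have Yv0 : Y v0 by rewrite -TY; exists x0.
  have vmax v : Y v -> `|v| <= 1 -> f v <= f v0.
    by rewrite -TY => -[x _ <-]; rewrite Tiso; exact: x0max.
  have fv00 : 0 <= f v0.
    by have := x0max 0; rewrite normr0 !linear0; apply.
  have gv0 : `|g| <= f v0.
    apply: dual_norm_le => // x; rewrite gE.
    have [->|z0] := eqVneq x 0; first by rewrite !linear0 !normr0 mulr0.
    have nx : 0 < `|x| by rewrite normr_gt0.
    have up z : `|z| = `|x| -> f (P z) <= f v0 * `|x|.
      move=> zx; rewrite -ler_pdivrMr// mulrC.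
      have := vmax (P (`|x|^-1 *: z)) (YP _).
      rewrite linearZ/= linearZ/=; apply.
      rewrite normrZ normfV normr_id ler_pdivrMl// mulr1 -zx; exact: P1.
    rewrite ler_norml up// andbT lerNl -linearN -linearN/=.
    by apply: up; rewrite normrN.
  have fv0 : f v0 = `|f|.
    apply/eqP; rewrite eq_le -{2}ng gv0 andbT.
    rewrite (le_trans (ler_norm _))// (le_trans (dual_bound f v0))//.
    by rewrite ler_piMr.
  have [f0|f0] := eqVneq `|f| 0.
    have g00 : g = 0 by apply/eqP; rewrite -normr_eq0 ng f0.
    move/eqP: f0; rewrite normr_eq0 => /eqP f0.
    by move: fgh; rewrite f0 g00 add0r => <-.
  have fp : 0 < `|f| by rewrite lt_neqAle eq_sym f0 normr_ge0.
  have nv0 : `|v0| = 1.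
    apply/eqP; rewrite eq_le v01/=.
    have := le_trans (ler_norm _) (dual_bound f v0).
    by rewrite fv0 ler_pMr.
  apply/val_inj/funext => x /=; rewrite -[LHS]/(h x) hE.
  apply: (@support_functional_orthogonal _ _ p1 f v0 (x - P x) m) => //.
    by move=> q mq; rewrite (Ym _ _ Yv0 mq) mul0r.
  move=> t; rewrite -{1}(Pid _ Yv0).
  have -> : P v0 = P (v0 + t *: (x - P x)).
    by rewrite linearD linearZ/= linearB/= Pidem subrr scaler0 addr0.
  exact: P1.
Qed.

End main.

Theorem theorem3p8 (R : realType) (p : R) (p_gt1 : 1 < p) (p_neq2 : p != 2)
    (n : nat) (Y : set (ell (ltW p_gt1))) :
  submod_closed (mem Y) -> has_dim Y n ->
  property_HB Y <->
  exists P : {linear ell (ltW p_gt1) -> ell (ltW p_gt1)},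
    [/\ projection_onto P Y,
        bi_contractive P,
        isometrically_isomorphic Y (ell_fin (ltW p_gt1) n) &
        isometrically_isomorphic (range (fun x => x - P x)) (ell (ltW p_gt1))].
Proof.
move=> _ dimY.
have PZ (P : {linear ell (ltW p_gt1) -> ell (ltW p_gt1)}) a x : P (a *: x) = a *: P x.
  exact: linearZ.
have QZ (P : {linear ell (ltW p_gt1) -> ell (ltW p_gt1)}) a x :
    a *: x - P (a *: x) = a *: (x - P x).
  by rewrite PZ scalerBr.
split=> [HB|[P [PY [/(opnorm_le1P (PZ P)) P1 /(opnorm_le1P (QZ P)) Q1] Yiso _]]].
  have [P [PY P1 Q1]] := HB_projection dimY HB.
  have [Yiso Kiso _] := bicontractive_structure p_neq2 dimY PY P1 Q1.
  exists P; split=> //.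
  by split; [apply/(opnorm_le1P (PZ P))|apply/(opnorm_le1P (QZ P))].
have [_ _ fin] := bicontractive_structure p_neq2 dimY PY P1 Q1.
exact: projection_HB PY P1 Q1 Yiso fin.
Qed.
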